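(* Let $n \ge 6$. There is no algorithm which, given as input a finite set $X$ of matrices in $\mathrm{GL}_n(\mathbb{Q})$, decides whether or not the subgroup $\langle X \rangle$ generated by $X$ contains a matrix whose upper left corner entry (the $(1,1)$-entry) is zero.
   Context: Matrices are given by their (rational) entries. ''Undecidable'' means that no algorithm (Turing machine) solves the problem for all inputs. *)

(* Defs.v *)
From HB Require Import structures.
From mathcomp Require Import all_boot all_order all_algebra.
Set Implicit Arguments. Unset Strict Implicit. Unset Printing Implicit Defensive.
Import Order.TTheory GRing.Theory Num.Theory.

Inductive rcode : Type :=
| RZero : rcode
| RSucc : rcode
| RProj : nat -> rcode
| RComp : rcode -> list rcode -> rcode
| RPrec : rcode -> rcode -> rcode
| RMin  : rcode -> rcode.

Inductive reval : rcode -> list nat -> nat -> Prop :=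
| ev_zero v : reval RZero v 0
| ev_succ v : reval RSucc v (nth 0 v 0).+1
| ev_proj i v : reval (RProj i) v (nth 0 v i)
| ev_comp f gs v ws y :
    reval_list gs v ws -> reval f ws y -> reval (RComp f gs) v y
| ev_prec0 f g v y : reval f v y -> reval (RPrec f g) (0 :: v) y
| ev_precS f g m v z y :
    reval (RPrec f g) (m :: v) z -> reval g (m :: z :: v) y ->
    reval (RPrec f g) (m.+1 :: v) y
| ev_min f v m :
    reval f (m :: v) 0 ->
    (forall k, k < m -> exists z, z <> 0 /\ reval f (k :: v) z) ->
    reval (RMin f) v m
with reval_list : list rcode -> list nat -> list nat -> Prop :=
| evl_nil v : reval_list nil v nil
| evl_cons g gs v w ws :
    reval g v w -> reval_list gs v ws -> reval_list (g :: gs) v (w :: ws).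

Inductive in_gen_group (n : nat) (X : seq 'M[rat]_n) : 'M[rat]_n -> Prop :=
| gen_one : in_gen_group X (1%R)%:M
| gen_mul A B : A \in X -> in_gen_group X B -> in_gen_group X (A *m B)
| gen_mulinv A B : A \in X -> in_gen_group X B -> in_gen_group X (invmx A *m B).

Definition corner_zero (n : nat) (A : 'M[rat]_n) : Prop :=
  exists i j : 'I_n, nat_of_ord i = 0 /\ nat_of_ord j = 0 /\ A i j = 0%R.

Definition has_corner_zero (n : nat) (X : seq 'M[rat]_n) : Prop :=
  exists A, in_gen_group X A /\ corner_zero A.

(* Inputs (finite lists of rational matrices) are encoded as naturals by the
   canonical (computable) countType encoding [pickle]. A program [c] decides the
   problem if on every valid input (all matrices invertible) it halts, and
   outputs 1 exactly on the yes-instances. *)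
Definition decides_corner_problem (n : nat) (c : rcode) : Prop :=
  forall X : seq 'M[rat]_n, all (fun A => A \in unitmx) X ->
    exists y, reval c [:: pickle X] y /\ (y = 1 <-> has_corner_zero X).

(* Main.v *)
Require Import Defs.
From mathcomp Require Import all_boot all_order all_algebra.
From mathcomp Require Import ring lra zify.
From Stdlib Require Import FunctionalExtensionality ClassicalEpsilon.
Set Implicit Arguments. Unset Strict Implicit. Unset Printing Implicit Defensive.
Import Order.TTheory GRing.Theory Num.Theory.

(* A decider c for the corner problem yields the recursive program
   p(k) = [c accepts the encoded instance X_k], and p can be compiled to a finite
   list of partial affine maps u m + a |-> u m' + c on the natural numbers which
   takes a start number for k to a fixed number h exactly when p(k) = 0.

   In a group generated by x, t and one stable letter r per map, with relations
   r x^m = x^m' r and r t_a = t_c r where t_n = x^n t x^-n, a letter kappa commuting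
   with t_h and all the r commutes with t_n as soon as n and h are connected by the
   maps.  Conversely, if some set C is invariant under the maps and contains h but
   not n, an explicit permutation model shows that kappa and t_n need not commute.
   Name their commutator zeta.

   Following Mihailova, the pairs (u, v) of words in a free group F that are equal
   in this group form a finitely generated subgroup of F x F.  Embedding F in
   SL_2(Z) by ping-pong and taking symmetric squares, F x F acts on Q^6 and, after a
   change of basis, the corner entry becomes a sum of two squares vanishing only at
   the pair (1, zeta^-1).  So the subgroup has a matrix with zero corner exactly when
   zeta = 1.

   The input k enters only through the generator (x^(2^k), xi), the other
   generators being fixed.  Hence X_k can be taken to be this matrix followed by the
   list encoded by k, and the choice of k as the code of the other generators makes c
   contradict itself, without a universal machine. *)

(** * Computable functions and encoded matrices *)

Definition computable1 (f : nat -> nat) := exists c, forall a, reval c [:: a] (f a).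
Definition computable2 (f : nat -> nat -> nat) :=
  exists c, forall a b, reval c [:: a; b] (f a b).

Lemma ev_comp1 f g v w y : reval g v w -> reval f [:: w] y -> reval (RComp f [:: g]) v y.
Proof. by move=> Hg Hf; apply: ev_comp Hf; do !constructor. Qed.

Lemma ev_comp2 f g h v w1 w2 y :
  reval g v w1 -> reval h v w2 -> reval f [:: w1; w2] y -> reval (RComp f [:: g; h]) v y.
Proof. by move=> Hg Hh Hf; apply: ev_comp Hf; do !constructor. Qed.

Lemma ev_projE i v y : nth 0 v i = y -> reval (RProj i) v y.
Proof. by move<-; constructor. Qed.

Lemma eq_computable1 f g : f =1 g -> computable1 f -> computable1 g.
Proof. by move=> E [c H]; exists c => a; rewrite -E. Qed.

Lemma computable1_id : computable1 id.
Proof. by exists (RProj 0) => a; apply: ev_projE. Qed.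

Lemma computable1_const n : computable1 (fun=> n).
Proof.
elim: n => [|n [c H]]; first by exists RZero; constructor.
by exists (RComp RSucc [:: c]) => a; apply: ev_comp1 (H a) _; constructor.
Qed.

Lemma computable1_comp f g : computable1 f -> computable1 g -> computable1 (fun a => f (g a)).
Proof.
by move=> [c Hc] [d Hd]; exists (RComp c [:: d]) => a; apply: ev_comp1 (Hd a) (Hc _).
Qed.

Lemma computable1_comp2 f g h : computable2 f -> computable1 g -> computable1 h ->
  computable1 (fun a => f (g a) (h a)).
Proof.
move=> [c Hc] [d Hd] [e He]; exists (RComp c [:: d; e]) => a.
by apply: ev_comp2 (Hd a) (He a) (Hc _ _).
Qed.

Lemma computable2_add : computable2 addn.
Proof.
exists (RPrec (RProj 0) (RComp RSucc [:: RProj 1])) => a b.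
elim: a => [|a IH]; first by constructor; constructor.
apply: ev_precS IH _; apply: ev_comp1; first exact: ev_proj.
exact: ev_succ.
Qed.

Lemma computable2_mul : computable2 muln.
Proof.
have [c Hc] := computable2_add.
exists (RPrec RZero (RComp c [:: RProj 2; RProj 1])) => a b.
elim: a => [|a IH]; first by constructor; constructor.
apply: ev_precS IH _; rewrite mulSn.
by apply: ev_comp2 (Hc _ _); apply: ev_projE.
Qed.

Lemma computable1_pred : computable1 predn.
Proof.
exists (RPrec RZero (RProj 0)); elim=> [|a IH]; first by constructor; constructor.
by apply: ev_precS IH _; apply: ev_projE.
Qed.

Lemma computable2_sub : computable2 subn.
Proof.
have [c Hc] := computable1_pred.
suff [d Hd] : computable2 (fun a b => b - a).
  by exists (RComp d [:: RProj 1; RProj 0]) => a b; apply: ev_comp2 (Hd _ _); apply: ev_projE.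
exists (RPrec (RProj 0) (RComp c [:: RProj 1])) => a b.
elim: a => [|a IH]; first by rewrite subn0; constructor; constructor.
by apply: ev_precS IH _; rewrite subnS; apply: ev_comp1 (Hc _); apply: ev_projE.
Qed.

Lemma computable1_pow2 : computable1 (expn 2).
Proof.
have [c Hc] := computable2_add; have [d Hd] := computable1_const 1.
exists (RPrec (RComp RSucc [:: RZero]) (RComp c [:: RProj 1; RProj 1])); elim=> [|a IH].
  by constructor; apply: ev_comp1; constructor.
apply: ev_precS IH _; rewrite expnS mul2n -addnn.
by apply: ev_comp2 (Hc _ _); apply: ev_projE.
Qed.

(** The cons step of [CodeSeq.code], on which the pickling of sequences, pairs and options rests. *)
Definition code_cons n m := 2 ^ n * m.*2.+1.

Lemma computable1_code_cons f g : computable1 f -> computable1 g ->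
  computable1 (fun a => code_cons (f a) (g a)).
Proof.
move=> Hf Hg; apply: (computable1_comp2 computable2_mul).
  exact: computable1_comp computable1_pow2 Hf.
apply: (@eq_computable1 (fun a => 1 + (g a + g a))) => [a|]; first by rewrite addnn.
apply: (computable1_comp2 computable2_add (computable1_const 1)).
exact: (computable1_comp2 computable2_add).
Qed.

Lemma computable1_code (T : Type) (s : seq T) (f : nat -> T -> nat) :
  (forall i, computable1 (f^~ i)) ->
  computable1 (fun k => CodeSeq.code [seq f k i | i <- s]).
Proof.
move=> Hf; elim: s => [|i s IH]; first exact: computable1_const.
exact: computable1_code_cons.
Qed.

Lemma computable1_if f g u v : computable1 f -> computable1 g -> computable1 u ->
  computable1 v -> computable1 (fun a => if f a <= g a then u a else v a).
Proof.
move=> Hf Hg Hu Hv.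
have Hs : computable1 (fun a => 1 - (f a - g a)).
  apply: (computable1_comp2 computable2_sub (computable1_const 1)).
  exact: computable1_comp2 computable2_sub _ _.
(* With truncated subtraction, [1 - (f a - g a)] is the indicator of [f a <= g a]. *)
apply: (@eq_computable1 (fun a => (1 - (f a - g a)) * u a + (1 - (1 - (f a - g a))) * v a)).
  move=> a; case: leqP => [/eqP->|]; first by rewrite subn0 subnn mul1n mul0n addn0.
  by rewrite -subn_gt0; case: (f a - g a) => // d _; rewrite subSS sub0n mul0n mul1n.
apply: (computable1_comp2 computable2_add);
  apply: (computable1_comp2 computable2_mul) => //.
exact: (computable1_comp2 computable2_sub (computable1_const 1)).
Qed.

(* Rational-valued functions that are differences of two computable functions:
   integer matrices depending on a parameter stay in this class under the
   matrix operations, without any computation on encoded rationals. *)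
Definition computableZ (f : nat -> rat) :=
  exists a b, [/\ computable1 a, computable1 b & forall k, f k = ((a k)%:R - (b k)%:R)%R].

Lemma pickle_ratz (z : int) :
  pickle (z%:~R : rat)%R = code_cons (pickle z) (code_cons (pickle (1 : int)%R) 0).
Proof. by rewrite -[(z%:~R)%R](ratzE z). Qed.

Lemma computable1_pickle_rat f : computableZ f -> computable1 (fun k => pickle (f k)).
Proof.
move=> [a [b [Ha Hb Hf]]].
pose c n := code_cons n (code_cons (pickle (1 : int)%R) 0).
(* An integer is pickled as an element of [nat + nat], hence as a pair of options exactly one of
   which is empty; the sign decides which. *)
apply: (@eq_computable1 (fun k => if b k <= a k
  then c (code_cons (code_cons (a k - b k) 0) (code_cons 0 0))
  else c (code_cons 0 (code_cons (code_cons (b k - a k).-1 0) 0)))).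
  move=> k; rewrite Hf /c; case: leqP => Hab.
    by rewrite -natrB // (pickle_ratz (Posz _)).
  suff -> : ((a k)%:R - (b k)%:R = (Negz (b k - a k).-1)%:~R :> rat)%R by rewrite pickle_ratz.
  by rewrite NegzE prednK ?subn_gt0 // mulrNz -opprB -natrB // ltnW.
have Hsub := computable1_comp2 computable2_sub.
have Hpred := computable1_comp computable1_pred (Hsub _ _ Hb Ha).
by apply: computable1_if => //; do !apply: computable1_code_cons;
  first [exact: computable1_const | exact: Hpred | exact: Hsub].
Qed.

Lemma eq_computableZ f g : f =1 g -> computableZ f -> computableZ g.
Proof. by move=> E [a [b [Ha Hb H]]]; exists a, b; split=> // k; rewrite -E. Qed.

Lemma computableZ_nat f : computable1 f -> computableZ (fun k => (f k)%:R)%R.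
Proof.
by move=> Hf; exists f, (fun=> 0); split=> // [|k]; [exact: computable1_const|rewrite subr0].
Qed.

Lemma computableZ_opp f : computableZ f -> computableZ (fun k => - f k)%R.
Proof. by move=> [a [b [Ha Hb H]]]; exists b, a; split=> // k; rewrite H opprB. Qed.

Lemma computableZ_add f g : computableZ f -> computableZ g -> computableZ (fun k => f k + g k)%R.
Proof.
move=> [a [b [Ha Hb H]]] [a' [b' [Ha' Hb' H']]].
exists (fun k => a k + a' k), (fun k => b k + b' k); split=> [||k];
  try exact: (computable1_comp2 computable2_add).
by rewrite H H' !natrD opprD addrACA.
Qed.

Lemma computableZ_mul f g : computableZ f -> computableZ g -> computableZ (fun k => f k * g k)%R.
Proof.
move=> [a [b [Ha Hb H]]] [a' [b' [Ha' Hb' H']]].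
exists (fun k => a k * a' k + b k * b' k), (fun k => a k * b' k + b k * a' k).
split=> [||k].
- by apply: (computable1_comp2 computable2_add); apply: (computable1_comp2 computable2_mul).
- by apply: (computable1_comp2 computable2_add); apply: (computable1_comp2 computable2_mul).
by rewrite H H' !natrD !natrM; ring.
Qed.

Lemma computableZ_sum (I : Type) (s : seq I) (P : pred I) (F : nat -> I -> rat) :
  (forall i, computableZ (F^~ i)) -> computableZ (fun k => \sum_(i <- s | P i) F k i)%R.
Proof.
move=> HF; elim: s => [|i s IH].
  by apply: eq_computableZ (computableZ_nat (computable1_const 0)) => k; rewrite big_nil.
case Pi: (P i).
  by apply: eq_computableZ (computableZ_add (HF i) IH) => k; rewrite big_cons Pi.
by apply: eq_computableZ IH => k; rewrite big_cons Pi.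
Qed.

Definition computableMx m n (A : nat -> 'M[rat]_(m, n)) :=
  forall i j, computableZ (fun k => A k i j).

Lemma computableMx_mul m n p (A : nat -> 'M[rat]_(m, n)) (B : nat -> 'M[rat]_(n, p)) :
  computableMx A -> computableMx B -> computableMx (fun k => A k *m B k)%R.
Proof.
move=> HA HB i j.
apply: (eq_computableZ (f := fun k => (\sum_l A k i l * B k l j)%R)) => [k|]; first by rewrite mxE.
by apply: computableZ_sum => l; apply: computableZ_mul.
Qed.

Lemma computableMx_block m1 m2 n1 n2 (A : nat -> 'M[rat]_(m1, n1)) (B : nat -> 'M[rat]_(m1, n2))
    (C : nat -> 'M[rat]_(m2, n1)) (D : nat -> 'M[rat]_(m2, n2)) :
  computableMx A -> computableMx B -> computableMx C -> computableMx D ->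
  computableMx (fun k => block_mx (A k) (B k) (C k) (D k)).
Proof.
move=> HA HB HC HD i j; rewrite -(splitK i) -(splitK j).
case: (split i) => i'; case: (split j) => j' /=.
- by apply: eq_computableZ (HA i' j') => k; rewrite block_mxEul.
- by apply: eq_computableZ (HB i' j') => k; rewrite block_mxEur.
- by apply: eq_computableZ (HC i' j') => k; rewrite block_mxEdl.
- by apply: eq_computableZ (HD i' j') => k; rewrite block_mxEdr.
Qed.

Section ComputableMatrices.
Local Open Scope ring_scope.

Lemma computableZ_const (a : nat) : computableZ (fun=> a%:R).
Proof. exact: computableZ_nat (computable1_const a). Qed.

Lemma computableZ_sub f g : computableZ f -> computableZ g -> computableZ (fun k => f k - g k).
Proof. by move=> Hf Hg; apply/computableZ_add/computableZ_opp. Qed.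

Lemma eq_computableMx m n (A B : nat -> 'M[rat]_(m, n)) :
  A =1 B -> computableMx A -> computableMx B.
Proof. by move=> E HA i j; apply: eq_computableZ (HA i j) => k; rewrite E. Qed.

Lemma computableMx_fun m n (F : nat -> 'I_m -> 'I_n -> rat) :
  (forall i j, computableZ (fun k => F k i j)) -> computableMx (fun k => \matrix_(i, j) F k i j).
Proof. by move=> HF i j; apply: eq_computableZ (HF i j) => k; rewrite mxE. Qed.

Lemma computableMx_delta m n i j : computableMx (fun=> delta_mx i j : 'M[rat]_(m, n)).
Proof. by move=> i' j'; apply: eq_computableZ (computableZ_const _) => k; rewrite mxE. Qed.

Lemma computableMx1 n : computableMx (fun=> 1%:M : 'M[rat]_n).
Proof. by move=> i j; apply: eq_computableZ (computableZ_const (i == j)) => k; rewrite mxE. Qed.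

Lemma computableMx0 m n : computableMx (fun=> 0 : 'M[rat]_(m, n)).
Proof. by move=> i j; apply: eq_computableZ (computableZ_const 0) => k; rewrite mxE. Qed.

Lemma computableMx_opp m n (A : nat -> 'M[rat]_(m, n)) :
  computableMx A -> computableMx (fun k => - A k).
Proof. by move=> HA i j; apply: eq_computableZ (computableZ_opp (HA i j)) => k; rewrite mxE. Qed.

Lemma computableMx_row_mx m n1 n2 (A : nat -> 'M[rat]_(m, n1)) (B : nat -> 'M[rat]_(m, n2)) :
  computableMx A -> computableMx B -> computableMx (fun k => row_mx (A k) (B k)).
Proof.
move=> HA HB i j; rewrite -(splitK j); case: (split j) => j' /=.
- by apply: eq_computableZ (HA i j') => k; rewrite row_mxEl.
- by apply: eq_computableZ (HB i j') => k; rewrite row_mxEr.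
Qed.

Lemma computableMx_col_mx m1 m2 n (A : nat -> 'M[rat]_(m1, n)) (B : nat -> 'M[rat]_(m2, n)) :
  computableMx A -> computableMx B -> computableMx (fun k => col_mx (A k) (B k)).
Proof.
move=> HA HB i j; rewrite -(splitK i); case: (split i) => i' /=.
- by apply: eq_computableZ (HA i' j) => k; rewrite col_mxEu.
- by apply: eq_computableZ (HB i' j) => k; rewrite col_mxEd.
Qed.

End ComputableMatrices.

(** A matrix is a finite function on index pairs, pickled as the list of its entries tagged with
    their indices. *)
Lemma pickle_mxE m n (A : 'M[rat]_(m, n)) :
  pickle A = CodeSeq.code
    [seq CodeSeq.code [:: pickle ij; pickle (A ij.1 ij.2)] | ij <- enum {: 'I_m * 'I_n}].
Proof.
transitivity (CodeSeq.code [seq pickle u | u <- codom (total_fun (mx_val A))]).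
  by rewrite codom_tffun.
by rewrite /codom /image_mem -map_comp; congr CodeSeq.code; apply: eq_map => -[i j].
Qed.

Lemma computable1_pickle_mx m n (A : nat -> 'M[rat]_(m, n)) :
  computableMx A -> computable1 (fun k => pickle (A k)).
Proof.
move=> HA; pose f k (ij : 'I_m * 'I_n) := CodeSeq.code [:: pickle ij; pickle (A k ij.1 ij.2)].
apply: (@eq_computable1 (fun k => CodeSeq.code [seq f k ij | ij <- enum {: 'I_m * 'I_n}])) => [k|].
  by rewrite pickle_mxE.
apply: computable1_code => ij; apply: computable1_code_cons; first exact: computable1_const.
apply: computable1_code_cons; last exact: computable1_const.
exact: computable1_pickle_rat.
Qed.

(** * Counter programs for recursive functions *)

Inductive prog := Skip | Inc of nat | Seq of prog & prog | Loop of nat & prog.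

Definition upd (s : nat -> nat) r v : nat -> nat := fun q => if q == r then v else s q.

(* [Loop r p] is: while register r is nonzero, decrement it and run p. *)
Inductive exec : prog -> (nat -> nat) -> (nat -> nat) -> Prop :=
| ex_skip s : exec Skip s s
| ex_inc r s : exec (Inc r) s (upd s r (s r).+1)
| ex_seq p q s1 s2 s3 : exec p s1 s2 -> exec q s2 s3 -> exec (Seq p q) s1 s3
| ex_loop0 r p s : s r = 0 -> exec (Loop r p) s s
| ex_loopS r p n s1 s2 s3 : s1 r = n.+1 -> exec p (upd s1 r n) s2 ->
    exec (Loop r p) s2 s3 -> exec (Loop r p) s1 s3.

Definition clear r := Loop r Skip.
Definition clears := foldr (fun r => Seq (clear r)) Skip.
Definition transfer r o := Loop r (Inc o).
(** Reading a register empties it, so its content is moved to both [o] and the scratch register [t],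
    then restored from [t]. *)
Definition copy_reg r o t := Seq (Loop r (Seq (Inc o) (Inc t))) (transfer t r).

Definition compile_list (c : rcode -> nat -> prog) :=
  fix compiles gs j := if gs is g :: gs' then Seq (c g j) (compiles gs' j.+1) else Skip.

(** [ins] are the argument registers, [o] receives the value, and registers from [b] on are free. In
    the [RPrec] case [b] counts the rounds left and [b.+1] those done, while [o] holds the current
    value; in the [RMin] case [o] is the candidate and [b] its test value. *)
Fixpoint compile (f : rcode) (ins : seq nat) (o b : nat) {struct f} : prog :=
  match f with
  | RZero => Skip
  | RSucc => if ins is r :: _ then Seq (copy_reg r o b) (Inc o) else Inc o
  | RProj i => if i < size ins then copy_reg (nth 0 ins i) o b else Skip
  | RComp f gs =>
      let n := size gs in
      Seq (compile_list (fun g j => compile g ins j (b + n)) gs b)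
        (Seq (compile f (iota b n) o (b + n)) (clears (iota b n)))
  | RPrec f g =>
      let body := Seq (compile g [:: b.+1, o & behead ins] b.+2 b.+3)
        (Seq (clear o) (Seq (transfer b.+2 o) (Inc b.+1))) in
      Seq (copy_reg (head 0 ins) b b.+1)
        (Seq (compile f (behead ins) o b.+3) (Seq (Loop b body) (clear b.+1)))
  | RMin f =>
      let test := compile f (o :: ins) b b.+1 in
      Seq test (Loop b (Seq (clear b) (Seq (Inc o) test)))
  end.

Lemma exec_eq p s t t' : exec p s t -> t = t' -> exec p s t'.
Proof. by move=> ? <-. Qed.

Ltac upd_tac := apply: functional_extensionality => ?; rewrite /upd /=;
  do ?[case: eqP => ? //=]; subst; try lia; try congruence.

Lemma exec_clear r s : exec (clear r) s (upd s r 0).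
Proof.
move En: (s r) => n; elim: n s En => [|n IH] s En.
  by apply: exec_eq (ex_loop0 _ En) _; upd_tac.
apply: ex_loopS En (ex_skip _) _.
by apply: exec_eq (IH _ _) _; [rewrite /upd eqxx|upd_tac].
Qed.

Lemma exec_clears rs s t : (forall r, t r = if r \in rs then 0 else s r) -> exec (clears rs) s t.
Proof.
elim: rs s => [|r rs IH] s Ht.
  have <- : s = t by apply: functional_extensionality => r; rewrite Ht.
  exact: ex_skip.
apply: ex_seq (exec_clear r s) (IH _ _) => q; rewrite Ht inE /upd.
by case: eqP => //= _; rewrite if_same.
Qed.

Lemma exec_transfer r o s : r != o -> exec (transfer r o) s (upd (upd s r 0) o (s o + s r)).
Proof.
move=> /eqP ro; move En: (s r) => n; elim: n s En => [|n IH] s En.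
  by apply: exec_eq (ex_loop0 _ En) _; upd_tac.
apply: ex_loopS En (ex_inc _ _) _.
by apply: exec_eq (IH _ _) _; [rewrite /upd; case: eqP => //; rewrite eqxx|upd_tac].
Qed.

Lemma exec_copy r o t s : r != o -> r != t -> o != t -> s o = 0 -> s t = 0 ->
  exec (copy_reg r o t) s (upd s o (s r)).
Proof.
move=> /eqP ro /eqP rt /eqP ot so st.
have H1 n : forall s, s r = n -> exec (Loop r (Seq (Inc o) (Inc t))) s
    (upd (upd (upd s r 0) o (s o + n)) t (s t + n)).
  elim: n => [|n IH] {so st}s En.
    by apply: exec_eq (ex_loop0 _ En) _; upd_tac.
  apply: ex_loopS En (ex_seq (ex_inc _ _) (ex_inc _ _)) _.
  apply: exec_eq (IH _ _) _; last by upd_tac.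
  by rewrite /upd; do ?case: eqP => //; rewrite eqxx.
apply: ex_seq (H1 _ _ erefl) _; apply: exec_eq (exec_transfer _ _) _.
  by apply/eqP; congruence.
by upd_tac.
Qed.

Fixpoint all_rcode (P : rcode -> Prop) gs :=
  if gs is g :: gs' then P g /\ all_rcode P gs' else True.

Lemma rcode_nested_ind (P : rcode -> Prop) :
  P RZero -> P RSucc -> (forall i, P (RProj i)) ->
  (forall f gs, P f -> all_rcode P gs -> P (RComp f gs)) ->
  (forall f g, P f -> P g -> P (RPrec f g)) ->
  (forall f, P f -> P (RMin f)) -> forall f, P f.
Proof.
move=> H0 HS HP HC HR HM; fix IH 1; case=> [||i|f gs|f g|f].
- exact: H0.
- exact: HS.
- exact: HP.
- by apply: HC (IH f) _; elim: gs => [|g gs IHgs] /=; split.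
- exact: HR (IH f) (IH g).
- exact: HM (IH f).
Qed.

Lemma reval_comp_inv f gs v y : reval (RComp f gs) v y ->
  exists2 ws, reval_list gs v ws & reval f ws y.
Proof. by inversion 1; exists ws. Qed.

Lemma reval_list_cons_inv g gs v ws : reval_list (g :: gs) v ws ->
  exists w ws', [/\ ws = w :: ws', reval g v w & reval_list gs v ws'].
Proof. by inversion 1; exists w, ws0. Qed.

Lemma reval_prec0_inv f g v y : reval (RPrec f g) (0 :: v) y -> reval f v y.
Proof. by inversion 1. Qed.

Lemma reval_precS_inv f g m v y : reval (RPrec f g) (m.+1 :: v) y ->
  exists2 z, reval (RPrec f g) (m :: v) z & reval g [:: m, z & v] y.
Proof. by inversion 1; exists z. Qed.

Lemma reval_min_inv f v m : reval (RMin f) v m -> reval f (m :: v) 0 /\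
  forall k, k < m -> exists2 z, z <> 0 & reval f (k :: v) z.
Proof.
move=> Hev; inversion Hev as [| | | | | |? ? ? H0 Hlt]; subst.
by split=> // k /Hlt[z []]; exists z.
Qed.

(** The final state agrees with [s] except at [o], so scratch registers are zero again and compiled
    code can be rerun in a loop. *)
Definition compile_spec f := forall v y, reval f v y -> forall ins o b s,
  v = map s ins -> all (gtn b) ins -> o < b -> o \notin ins -> s o = 0 ->
  (forall r, b <= r -> s r = 0) -> exec (compile f ins o b) s (upd s o y).

Lemma map_upd s ins o y : o \notin ins -> map (upd s o y) ins = map s ins.
Proof.
move=> Ho; apply/eq_in_map => r Hr; rewrite /upd; case: eqP => // E.
by rewrite -E Hr in Ho.
Qed.

Lemma lt_notin b ins r : all (gtn b) ins -> b <= r -> r \notin ins.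
Proof. by move=> /allP H br; apply/negP => /H /=; rewrite ltnNge br. Qed.

Lemma compile_prec f g : compile_spec f -> compile_spec g -> compile_spec (RPrec f g).
Proof.
move=> Hf Hg v y Hev [|r ins] o b s Ev; first by rewrite Ev in Hev; inversion Hev.
rewrite /= inE negb_or => /andP[rb insb] ob /andP[/eqP or oins] so sb.
rewrite Ev /= in Hev; move Er: (s r) Hev => m Hev {Ev}.
have insP q : q \in ins -> q < b by move/(allP insb).
set body := Seq (compile g _ _ _) _.
pose st c i z := upd (upd (upd s b c) b.+1 i) o z.
have stins c i z : map (st c i z) ins = map s ins.
  by rewrite /st !map_upd // (lt_notin insb).
(* The loop counts down while the derivation recurses on [m]. Leaving [e] further rounds and the
   final state open lets the last round be prepended before the induction hypothesis supplies the
   earlier ones. *)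
have [y0 [Hy0 Hl]] : exists y0, reval f (map s ins) y0 /\ forall e t,
    exec (Loop b body) (st e m y) t -> exec (Loop b body) (st (m + e) 0 y0) t.
  elim: m y {Er} Hev => [|m IH] y Hev.
    by exists y; split=> //; exact: reval_prec0_inv Hev.
  have [z Hz Hgz] := reval_precS_inv Hev; have [y0 [Hy0 Hl]] := IH _ Hz.
  exists y0; split=> // e t Ht; rewrite addSnnS; apply: Hl.
  apply: (ex_loopS (n := e) (s2 := st e m.+1 y)) => //.
    by rewrite /st /upd; do ?case: eqP => //; lia.
  have -> : upd (st e.+1 m z) b e = st e m z by rewrite /st; upd_tac.
  apply: ex_seq; first apply: (Hg _ _ Hgz).
  - rewrite /= stins.
    by congr [:: _, _ & _]; rewrite /st /upd; do ?case: eqP => //; lia.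
  - by apply/allP => q; rewrite !inE => /or3P[/eqP->|/eqP->|/insP] /=; lia.
  - by [].
  - by rewrite !inE !negb_or (lt_notin insb) ?andbT //; lia.
  - by rewrite /st /upd; do ?case: eqP => //; try lia; move=> *; apply: sb; lia.
  - by move=> q Hq; rewrite /st /upd; do ?case: eqP => //; try lia; move=> *; apply: sb; lia.
  apply: ex_seq (exec_clear _ _) _; apply: ex_seq; first by apply: exec_transfer; lia.
  apply: exec_eq (ex_inc _ _) _; rewrite /st; upd_tac.
  by rewrite sb //; lia.
apply: ex_seq; first apply: exec_copy; try lia; try by apply: sb; lia.
apply: ex_seq.
  apply: (Hf _ _ Hy0) => //.
  - by rewrite map_upd // (lt_notin insb).
  - by apply: sub_all insb => q /=; lia.
  - by lia.
  - by rewrite /upd; case: eqP => //; lia.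
  - by move=> q Hq; rewrite /upd; case: eqP => // *; try lia; apply: sb; lia.
apply: (ex_seq (s2 := st 0 m y)).
  rewrite (_ : upd _ _ _ = st (m + 0) 0 y0); last first.
    by rewrite /st; upd_tac; rewrite sb; lia.
  by apply: Hl; apply: ex_loop0; rewrite /st /upd; do ?case: eqP => //; lia.
apply: exec_eq (exec_clear _ _) _; rewrite /st; upd_tac; by rewrite sb //; lia.
Qed.

Lemma compile_min f : compile_spec f -> compile_spec (RMin f).
Proof.
move=> Hf v m Hev ins o b s Ev insb ob oins so sb.
rewrite {v}Ev in Hev; have [Hev0 Hlt] := reval_min_inv Hev.
have insP q : q \in ins -> q < b by move/(allP insb).
rewrite /=; set test := compile _ _ _ _.
set l := Loop _ _.
have Ht k z t : reval f (k :: map s ins) z -> t = upd s o k -> exec test t (upd t b z).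
  move=> Hz ->; apply: (Hf _ _ Hz).
  - by rewrite /= map_upd //; congr (_ :: _); rewrite /upd eqxx.
  - by apply/allP => q; rewrite inE => /orP[/eqP->|/insP] /=; lia.
  - by [].
  - by rewrite inE negb_or (lt_notin insb) // andbT; lia.
  - by rewrite /upd; case: eqP => [|_]; [lia|apply: sb].
  - by move=> r br; rewrite /upd; case: eqP => [|_]; [lia|apply: sb; lia].
(* Induction on the number [d] of candidates still to be rejected; register [b] already holds the
   test value of [k]. *)
have Hl d k : k + d = m -> exists2 z, reval f (k :: map s ins) z &
    exec l (upd (upd s o k) b z) (upd s o m).
  elim: d k => [|d IH] k Ek.
    exists 0; first by have -> : k = m by lia.
    by apply: exec_eq (ex_loop0 _ _) _; [rewrite /upd eqxx|upd_tac; rewrite sb //; lia].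
  have [|z z0 Hz] := Hlt k; first by lia.
  have [|z' Hz' El] := IH k.+1; first by lia.
  exists z => //; case: z z0 {Hz} => // z _.
  apply: ex_loopS El; first by rewrite /upd eqxx.
  apply: ex_seq (exec_clear _ _) _; apply: ex_seq (ex_inc _ _) _.
  apply: exec_eq (Ht _ _ _ Hz' _) _; upd_tac.
  by rewrite sb //; lia.
have [//|z Hz El] := Hl m 0; apply: ex_seq El; apply: exec_eq (Ht _ _ _ Hz _) _; upd_tac.
Qed.

Lemma compile_comp f gs : compile_spec f -> all_rcode compile_spec gs -> compile_spec (RComp f gs).
Proof.
move=> Hf Hgs v y Hev ins o b s Ev insb ob oins so sb.
rewrite {v}Ev in Hev; have [vs Hvs Hfv] := reval_comp_inv Hev.
rewrite /=; set n := size gs; set cs := compile_list _.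
have Hcs : forall gs ws, all_rcode compile_spec gs -> reval_list gs (map s ins) ws ->
   forall j t, b <= j -> j + size gs <= b + n -> map t ins = map s ins ->
   (forall r, j <= r -> t r = 0) ->
   size ws = size gs /\ exec (cs gs j) t (fun r => if r < j then t r else nth 0 ws (r - j)).
  elim=> [|g gs' IH] ws Hall Hrl j t bj jn Et tj; rewrite /=.
    have -> : ws = [::] by inversion Hrl.
    split=> //; apply: exec_eq (ex_skip _) _; apply: functional_extensionality => r.
    by rewrite nth_nil; case: ltnP => // /tj.
  have [Hg Hall'] := Hall; have [w [ws' [-> Hw Hws']]] := reval_list_cons_inv Hrl.
  have jins : j \notin ins by apply: lt_notin insb bj.
  rewrite /= in jn.
  have [||||sz Hex] := IH _ Hall' Hws' j.+1 (upd t j w); try lia.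
  - by rewrite map_upd.
  - by move=> r jr; rewrite /upd; case: eqP => [|_]; [lia|apply: tj; lia].
  split; [by rewrite /= sz|apply: (ex_seq (s2 := upd t j w))].
    apply: (Hg _ _ Hw) => //; try lia; try (by rewrite Et).
    + by apply: sub_all insb => r /=; lia.
    + exact: tj.
    + by move=> r ?; apply: tj; lia.
  apply: exec_eq Hex _; apply: functional_extensionality => r; rewrite ltnS /upd.
  case: ltngtP => // [jr|->]; last by rewrite subnn.
  by rewrite -[in RHS](subnSK jr).
have [||||sz Hex] := Hcs _ _ Hgs Hvs b s; try lia; try by [].
apply: ex_seq Hex _; apply: ex_seq; first apply: (Hf _ _ Hfv).
- apply: (@eq_from_nth _ 0); rewrite ?size_map ?size_iota // => i; rewrite sz => Hi.
  rewrite (nth_map 0) ?size_iota // nth_iota //.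
  by rewrite ltnNge leq_addr /= addKn.
- by apply/allP => r /=; rewrite mem_iota => /andP[].
- by lia.
- by rewrite mem_iota; lia.
- by rewrite ob.
- by move=> r Hr; rewrite ltnNge (leq_trans _ Hr) ?leq_addr //= nth_default // sz; lia.
apply: exec_clears => r; rewrite mem_iota /upd; case: eqP => [->|_]; first by case: ifP => //; lia.
case: (ltnP r b) => //= br; case: ltnP => Hr; first exact: sb.
by rewrite sb // nth_default // sz; lia.
Qed.

Lemma compile_correct f : compile_spec f.
Proof.
elim/rcode_nested_ind: f => [||i|f gs Hf Hgs|f g Hf Hg|f Hf].
- move=> v y Hev ins o b s _ _ _ _ so _; inversion Hev; subst => /=.
  by apply: exec_eq (ex_skip _) _; upd_tac.
- move=> v y Hev [|r ins] o b s Ev insb ob oins so sb; inversion Hev; subst => /=.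
    by apply: exec_eq (ex_inc _ _) _; rewrite so.
  move: insb oins => /= /andP[rb _]; rewrite inE negb_or => /andP[or _].
  apply: ex_seq.
    by apply: exec_copy => //; rewrite ?sb //; lia.
  by apply: exec_eq (ex_inc _ _) _; upd_tac.
- move=> v y Hev ins o b s Ev insb ob oins so sb; inversion Hev; subst => /=.
  case: ltnP => Hi.
    have Hr := mem_nth 0 Hi; have /= Hrb := allP insb _ Hr.
    rewrite (nth_map 0) //; apply: exec_copy => //; try lia; last exact: sb.
    by apply/eqP => E; rewrite -E Hr in oins.
  by apply: exec_eq (ex_skip _) _; rewrite nth_default ?size_map //; upd_tac.
- exact: compile_comp.
- exact: compile_prec.
- exact: compile_min.
Qed.

(** * Partial affine maps simulating counter programs *)

Fixpoint nprime r := if r is r'.+1 then s2val (prime_above (nprime r')) else 2.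

Lemma nprime_prime r : prime (nprime r).
Proof. by case: r => //= r; case: (prime_above _). Qed.

Arguments nprime : simpl never.

Lemma nprime_inj : injective nprime.
Proof.
have H : {homo nprime : i j / i < j}.
  by apply: homo_ltn => [? ? ?|r /=]; [exact: ltn_trans|rewrite /nprime; case: (prime_above _)].
by move=> i j E; case: (ltngtP i j) => // /H; rewrite E ltnn.
Qed.

(** Gödel numbering: an increment multiplies by a prime, and the zero test becomes a divisibility
    test. *)
Definition enc R (s : nat -> nat) := \prod_(r < R) nprime r ^ s r.

Lemma enc_upd R s r n : r < R -> s r = 0 -> enc R (upd s r n) = nprime r ^ n * enc R s.
Proof.
move=> rR sr; rewrite /enc (bigD1 (Ordinal rR)) //= [in RHS](bigD1 (Ordinal rR)) //=.
rewrite /upd eqxx sr expn0 mul1n.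
by congr (_ * _); apply: eq_bigr => i; rewrite -val_eqE => /= /negPf ->.
Qed.

Lemma enc_dvd R s r : s r = 0 -> ~~ (nprime r %| enc R s).
Proof.
move=> sr; apply/negP; rewrite /enc.
elim/big_rec: _ => [|i x _ IH]; first by rewrite dvdn1 => /eqP E; have := nprime_prime r; rewrite E.
rewrite Euclid_dvdM ?nprime_prime // => /orP[|//].
have [si|si] := posnP (s i); first by rewrite si dvdn1 => /eqP E; have := nprime_prime r; rewrite E.
rewrite Euclid_dvdX ?nprime_prime // si andbT dvdn_prime2 ?nprime_prime // => /eqP /nprime_inj E.
by rewrite -E sr in si.
Qed.

Lemma enc_inc R s r : r < R -> enc R (upd s r (s r).+1) = nprime r * enc R s.
Proof.
move=> rR; have [s0 s0r E] : exists2 s0, s0 r = 0 & forall n, upd s r n = upd s0 r n.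
  exists (upd s r 0) => [|n]; first by rewrite /upd eqxx.
  by apply: functional_extensionality => q; rewrite /upd; case: eqP.
have Es : s = upd s0 r (s r).
  by rewrite -E; apply: functional_extensionality => q; rewrite /upd; case: eqP => // ->.
by rewrite E [in RHS]Es !enc_upd // expnS mulnA.
Qed.

(* ((q, m, a), (q', m', c)): in state q with memory u * m + a, go to state q'
   with memory u * m' + c. *)
Definition instr := ((nat * nat * nat) * (nat * nat * nat))%type.

Inductive step (P : seq instr) : nat * nat -> nat * nat -> Prop :=
| Step q m a q' m' c u : ((q, m, a), (q', m', c)) \in P ->
    step P (q, u * m + a) (q', u * m' + c).

Inductive steps P : nat * nat -> nat * nat -> Prop :=
| steps_refl x : steps P x x
| steps_cons x y z : step P x y -> steps P y z -> steps P x z.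

Definition deterministic P := forall x y z, step P x y -> step P x z -> y = z.

(** Loop test with decrement. Each nonzero residue [d] needs its own affine map, which leaves the
    memory unchanged. *)
Definition div_instrs q p q1 q2 : seq instr :=
  ((q, p, 0), (q1, 1, 0)) :: [seq ((q, p, d), (q2, p, d)) | d <- iota 1 p.-1].

(** [qi] and [qo] are the entry and exit states, and [n] is the first state not yet in use. *)
Fixpoint flatten_prog p qi qo n : seq instr * nat :=
  match p with
  | Skip => ([:: ((qi, 1, 0), (qo, 1, 0))], n)
  | Inc r => ([:: ((qi, 1, 0), (qo, nprime r, 0))], n)
  | Seq p1 p2 =>
      let (P1, n1) := flatten_prog p1 qi n n.+1 in
      let (P2, n2) := flatten_prog p2 n qo n1 in (P1 ++ P2, n2)
  | Loop r p1 =>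
      let (P1, n1) := flatten_prog p1 n qi n.+1 in
      (P1 ++ div_instrs qi (nprime r) n qo, n1)
  end.

Fixpoint registers p := match p with
  | Skip => 0 | Inc r => r.+1
  | Seq p q => maxn (registers p) (registers q)
  | Loop r p => maxn r.+1 (registers p) end.

Lemma steps_trans P x y z : steps P x y -> steps P y z -> steps P x z.
Proof. by move=> Hxy; elim: Hxy => // {}x x' {}y Hs _ IH /IH; apply: steps_cons. Qed.

Lemma sub_steps P Q x y : {subset P <= Q} -> steps P x y -> steps Q x y.
Proof.
move=> PQ; elim=> [|{}x x' {}y Hs _ IH]; first by constructor.
by apply: steps_cons IH; case: Hs => *; constructor; apply: PQ.
Qed.

Lemma step_div P q p q1 q2 N : 0 < p -> {subset div_instrs q p q1 q2 <= P} ->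
  step P (q, N) (if p %| N then (q1, N %/ p) else (q2, N)).
Proof.
move=> p0 sP; case: ifP => pN.
  have := @Step P q p 0 q1 1 0 (N %/ p); rewrite !addn0 muln1 divnK //; apply.
  by apply: sP; rewrite inE eqxx.
have := @Step P q p (N %% p) q2 p (N %% p) (N %/ p); rewrite -divn_eq; apply.
apply: sP; rewrite inE; apply/orP; right; apply: map_f.
by rewrite mem_iota lt0n [_ == _]pN /= add1n prednK // ltn_mod.
Qed.

Lemma step_mul P q c q' N : ((q, 1, 0), (q', c, 0)) \in P -> step P (q, N) (q', c * N).
Proof. by move=> /(@Step _ _ _ _ _ _ _ N); rewrite muln1 !addn0 mulnC. Qed.

Lemma flatten_exec R p s t qi qo n : exec p s t -> registers p <= R ->
  steps (flatten_prog p qi qo n).1 (qi, enc R s) (qo, enc R t).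
Proof.
move=> H; elim: H qi qo n => {p s t} /=
  [s|r s|p q s1 s2 s3 _ IH1 _ IH2|r p s sr|r p k s1 s2 s3 sr _ IH1 _ IH2] qi qo n HR.
- apply: steps_cons (steps_refl _ _); rewrite -[in X in step _ _ (_, X)](mul1n (enc R s)).
  by apply: step_mul; rewrite inE.
- apply: steps_cons (steps_refl _ _); rewrite enc_inc //.
  by apply: step_mul; rewrite inE.
- move: HR (IH1 qi n n.+1) (IH2 n qo); rewrite geq_max => /andP[HR1 HR2].
  case: (flatten_prog p _ _ _) => P1 n1 /(_ HR1) S1 /(_ n1 HR2).
  case: (flatten_prog q _ _ _) => P2 n2 S2 /=.
  apply: (@steps_trans _ _ (n, enc R s2)).
    by apply: sub_steps S1 => x; rewrite mem_cat => ->.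
  by apply: sub_steps S2 => x; rewrite mem_cat => ->; rewrite orbT.
- case: (flatten_prog p _ _ _) => P1 n1 /=.
  have := @step_div (P1 ++ div_instrs qi (nprime r) n qo) qi (nprime r) n qo (enc R s).
  rewrite (negPf (enc_dvd _ sr)) => Hs; apply: steps_cons (Hs _ _) (steps_refl _ _).
    exact: prime_gt0 (nprime_prime _).
  by move=> x; rewrite mem_cat => ->; rewrite orbT.
- have [rR HR1] : r < R /\ registers p <= R by move: HR; rewrite geq_max => /andP[].
  move: (IH1 n qi n.+1 HR1) (IH2 qi qo n HR) => {IH1 IH2} /=.
  case: (flatten_prog p _ _ _) => P1 n1 /= S1 S2.
  have := @step_div (P1 ++ div_instrs qi (nprime r) n qo) qi (nprime r) n qo (enc R s1).
  have p0 := prime_gt0 (nprime_prime r).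
  have -> : enc R s1 = nprime r * enc R (upd s1 r k).
    rewrite -enc_inc // /upd eqxx; congr (enc _ _).
    by apply: functional_extensionality => q; case: eqP => // ->.
  rewrite dvdn_mulr // mulKn // => Hs; apply: steps_cons (Hs _ _) _ => //.
    by move=> x; rewrite mem_cat => ->; rewrite orbT.
  apply: steps_trans S2; apply: sub_steps S1 => x.
  by rewrite mem_cat => ->.
Qed.

Definition sources_in (A : pred nat) (P : seq instr) := {in P, forall I, A I.1.1.1}.

Lemma step_source A P x y : sources_in A P -> step P x y -> A x.1.
Proof. by move=> HA [q m a q' m' c u /HA]. Qed.

Lemma step_cat P Q x y : step (P ++ Q) x y -> step P x y \/ step Q x y.
Proof. by case=> q m a q' m' c u; rewrite mem_cat => /orP[]; [left|right]; constructor. Qed.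

Lemma deterministic_cat A P Q : sources_in A P -> sources_in (predC A) Q ->
  deterministic P -> deterministic Q -> deterministic (P ++ Q).
Proof.
move=> HP HQ dP dQ x y z /step_cat[] Hy /step_cat[] Hz; try exact: dP Hz; try exact: dQ Hz.
- by have := step_source HQ Hz; rewrite /= (step_source HP Hy).
- by have := step_source HQ Hy; rewrite /= (step_source HP Hz).
Qed.

Lemma step_mul_eq q c q' x y : step [:: ((q, 1, 0), (q', c, 0))] x y -> y = (q', c * x.2).
Proof.
by case=> q1 m a q1' m' d u; rewrite inE => /eqP[-> -> -> -> -> ->]; rewrite !addn0 muln1 mulnC.
Qed.

Lemma deterministic_mul q c q' : deterministic [:: ((q, 1, 0), (q', c, 0))].
Proof. by move=> x y z /step_mul_eq-> /step_mul_eq->. Qed.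

Lemma step_div_eq q p q1 q2 x y : 0 < p -> step (div_instrs q p q1 q2) x y ->
  y = if p %| x.2 then (q1, x.2 %/ p) else (q2, x.2).
Proof.
move=> p0 [q3 m a q' m' c u]; rewrite inE => /orP[/eqP[-> -> -> -> -> ->]|/mapP[d]].
  by rewrite /= !addn0 dvdn_mull // mulnK // muln1.
rewrite mem_iota add1n prednK // => /andP[d0 dp] [-> -> -> -> -> ->] /=.
by rewrite dvdn_addr ?dvdn_mull // gtnNdvd.
Qed.

(** Each piece leaves only [qi] or states created by itself, so glued pieces have disjoint sources.
    An exit state other than [qi] is therefore a halting state. *)
Lemma flatten_deterministic p qi qo n : qi < n -> qo < n ->
  let (P, n') := flatten_prog p qi qo n in
  [/\ n <= n', sources_in [pred q | (q == qi) || (n <= q < n')] P, deterministic P &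
    {in P, forall I, [/\ I.1.1.1 < n', I.2.1.1 < n', I.1.2 < I.1.1.2 & I.2.2 < I.2.1.2]}].
Proof.
elim: p qi qo n => [|r|p IHp q IHq|r p IHp] qi qo n Hi Ho /=.
- split=> //; last by move=> I; rewrite mem_seq1 => /eqP->.
  + by move=> I; rewrite mem_seq1 => /eqP-> /=; rewrite eqxx.
  + exact: deterministic_mul.
- split=> //.
  + by move=> I; rewrite mem_seq1 => /eqP-> /=; rewrite eqxx.
  + exact: deterministic_mul.
  + by move=> I; rewrite mem_seq1 => /eqP-> /=; split=> //; exact: prime_gt0 (nprime_prime r).
- have := IHp qi n n.+1 (ltnW Hi) (ltnSn n); case: (flatten_prog p _ _ _) => P1 n1 [le1 S1 D1 B1].
  have := IHq n qo n1 le1 (leq_trans Ho (ltnW le1)).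
  case: (flatten_prog q _ _ _) => P2 n2 [le2 S2 D2 B2].
  split; first by lia.
  + move=> I; rewrite mem_cat => /orP[/S1|/S2] /=; lia.
  + apply: (deterministic_cat S1) => // I /S2 /=; lia.
  + move=> I; rewrite mem_cat => /orP[/B1[]|/B2[]]; split=> //; lia.
have := IHp n qi n.+1 (ltnSn n) (ltnW Hi); case: (flatten_prog p _ _ _) => P1 n1 [le1 S1 D1 B1].
have p0 := prime_gt0 (nprime_prime r).
have Sd : sources_in (pred1 qi) (div_instrs qi (nprime r) n qo).
  by move=> I; rewrite inE => /orP[/eqP->|/mapP[d _ ->]] /=; rewrite eqxx.
split; first by lia.
- move=> I; rewrite mem_cat => /orP[/S1|/Sd] /=; lia.
- apply: (@deterministic_cat (predC (pred1 qi))) => // [I /S1 /=|I /Sd /=|x y z Hy Hz];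
    [lia|lia|].
  by rewrite (step_div_eq p0 Hy) (step_div_eq p0 Hz).
- move=> I; rewrite mem_cat => /orP[/B1[]|]; first by split=> //; lia.
  rewrite inE => /orP[/eqP->|/mapP[d Hd ->]] /=; first by split=> //; lia.
  by move: Hd; rewrite mem_iota => Hd; split; lia.
Qed.

(* (m, a, m', c) is the partial affine map u * m + a |-> u * m' + c. *)
Definition affine := (nat * nat * (nat * nat))%type.

(** Being closed in both directions, such a set is a union of classes of the equivalence generated
    by the maps. *)
Definition affine_invariant (P : seq affine) (C : nat -> Prop) :=
  forall m a m' c, (m, a, (m', c)) \in P -> forall u, C (u * m + a) <-> C (u * m' + c).

Lemma steps_det P x y z : deterministic P -> (forall w, ~ step P y w) -> (forall w, ~ step P z w) ->
  steps P x y -> steps P x z -> y = z.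
Proof.
move=> dP Hy Hz Hxy; elim: Hxy Hy => [{}x|{}x x' {}y Hs _ IH] Hy Hxz.
  by inversion Hxz as [|? w ? Hw]; subst => //; case: (Hy w).
inversion Hxz as [|? w ? Hw Hwz]; subst; first by case: (Hz x').
by apply: IH => //; rewrite (dP _ _ _ Hs Hw).
Qed.

Lemma base_inj S N N' q q' : q < S -> q' < S -> S * N + q = S * N' + q' -> q = q' /\ N = N'.
Proof.
move=> qS q'S E; have S0 : 0 < S by lia.
split; first by have := congr1 (modn^~ S) E; rewrite /= !(mulnC S) !modnMDl !modn_small.
by have := congr1 (divn^~ S) E; rewrite /= !(mulnC S) !divnMDl // !divn_small // !addn0.
Qed.

(** A configuration is folded into one number [S * N + q]. The run starts in state 0 with memory
    [2 ^ k] and halts in state 1 with memory [nprime 1 ^ y], so [h] codes the halting configuration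
    of output 0. *)
Lemma rcode_affine (f : rcode) : exists (P : seq affine) S q0 h,
  {in P, forall I, I.1.2 < I.1.1 /\ I.2.2 < I.2.1} /\
  forall k y, reval f [:: k] y ->
    (y = 0 -> forall C, affine_invariant P C -> C h -> C (S * 2 ^ k + q0)) /\
    (y <> 0 -> exists C, [/\ affine_invariant P C, C h & ~ C (S * 2 ^ k + q0)]).
Proof.
(* Clearing the input register makes the halting memory depend on [y] alone. *)
pose p := Seq (compile f [:: 0] 1 2) (clear 0).
have := @flatten_deterministic p 0 1 2 isT isT; have := @flatten_exec (maxn 2 (registers p)) p.
case Ep: (flatten_prog p 0 1 2) => [P S] Hex [S2 src dP HP].
pose aff (I : instr) : affine :=
  (S * I.1.1.2, S * I.1.2 + I.1.1.1, (S * I.2.1.2, S * I.2.2 + I.2.1.1)).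
exists (map aff P), S, 0, (S * 1 + 1); split.
  by move=> _ /mapP[I /HP[lt1 lt2 lt3 lt4] ->] /=; split; nia.
move=> k y Hy; pose s0 := upd (fun=> 0) 0 k; pose s1 := upd (fun=> 0) 1 y.
have {Hex} Hex : steps P (0, 2 ^ k) (1, nprime 1 ^ y).
  have Ep0 : exec p s0 s1.
    apply: ex_seq; first by apply: (compile_correct Hy) => // r;
      rewrite /s0 /upd; case: eqP => // ->.
    by apply: exec_eq (exec_clear _ _) _; rewrite /s1 /s0; upd_tac.
  have := Hex s0 s1 0 1 2 Ep0 (leq_maxr _ _); rewrite Ep /=.
  have e0 : enc (maxn 2 (registers p)) (fun=> 0) = 1 by rewrite /enc big1.
  by rewrite !enc_upd ?leq_max // e0 !muln1.
have stuck N w : ~ step P (1, N) w.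
  by move=> /(step_source src) /=.
split=> [y0 C HC | y0].
  move: Hex; rewrite y0 expn0.
  have H x z : steps P x z -> C (S * z.2 + z.1) -> C (S * x.2 + x.1).
    elim=> {x z} // x y' z Hs _ IH /IH; case: Hs => q m a q' m' c u Hin /=.
    have /HC/(_ u) := map_f aff Hin.
    by rewrite /= !mulnDr ![S * (u * _)]mulnCA !addnA => -[].
  by move=> /H.
(* The configurations that reach the halting configuration of output 0. Determinism makes this set
   closed forwards too, and a start that halts elsewhere lies outside it. *)
exists (fun x => exists q N, [/\ q < S, x = S * N + q & steps P (q, N) (1, 1)]); split.
- move=> m a m' c /mapP[[[[q m0] a0] [[q' m0'] c0]] Hin [-> -> -> ->]] u.
  have [/= lt1 lt2 _ _] := HP _ Hin.
  have E b d q1 : u * (S * b) + (S * d + q1) = S * (u * b + d) + q1 by lia.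
  rewrite !E; split=> -[q1 [N [ltq EN Hst]]].
  + have [Eq EN'] : q1 = q /\ N = u * m0 + a0 by apply: base_inj (esym EN).
    exists q', (u * m0' + c0); split=> //; move: Hst; rewrite Eq EN' => Hst.
    have Hs := Step u Hin.
    inversion Hst as [? Ex Ey|? w ? Hw Hwz]; first by move: Hs; rewrite Ey => /stuck.
    by rewrite (dP _ _ _ Hs Hw).
  + have [Eq EN'] : q1 = q' /\ N = u * m0' + c0 by apply: base_inj (esym EN).
    exists q, (u * m0 + a0); split=> //; move: Hst; rewrite Eq EN'.
    exact/steps_cons/Step.
- by exists 1, 1; split=> //; constructor.
- move=> [q [N [ltq EN Hst]]].
  have [Eq EN'] : q = 0 /\ N = 2 ^ k by apply: base_inj (esym EN); rewrite // (leq_trans _ S2).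
  rewrite {}Eq {}EN' in Hst.
  have [] := steps_det dP (@stuck _) (@stuck _) Hex Hst.
  by case: y y0 {Hy s1 Hex} => // y _ /eqP; rewrite expnS muln_eq1 => /andP[/eqP E];
    have := nprime_prime 1; rewrite E.
Qed.

(** * The group and its permutation model *)

(* The letter (i, true) is the inverse of (i, false). *)
Definition word := seq (nat * bool).

Definition winv (w : word) : word := rev [seq (l.1, ~~ l.2) | l <- w].

Lemma winvK : involutive winv.
Proof.
move=> w; rewrite /winv map_rev revK -map_comp -[RHS]map_id.
by apply: eq_map => -[i b] /=; rewrite negbK.
Qed.

Definition gen i : word := [:: (i, false)].
Definition pow i n : word := nseq n (i, false).

(* Letters: 0 is zeta, 1 is x, 2 is t, 3 is kappa, 4 is xi (a name for the input power
   of x), and 5 + i is the stable letter of the i-th affine map. *)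
Definition zeta := gen 0.
Definition tee := gen 2.
Definition kappa := gen 3.
Definition stable i := gen i.+4.+1.

Definition conjw (u v : word) : word := u ++ v ++ winv u.
Definition lamp n := conjw (pow 1 n) tee.
(** Given x^K = xi this equals [lamp (S * K + q0)], yet the word itself does not depend on [K]. *)
Definition start_lamp S q0 := conjw (pow 4 S ++ pow 1 q0) tee.

Definition stable_relators i (I : affine) : seq (word * word) :=
  [:: (stable i ++ pow 1 I.1.1, pow 1 I.2.1 ++ stable i);
      (stable i ++ lamp I.1.2, lamp I.2.2 ++ stable i);
      (kappa ++ stable i, stable i ++ kappa)].

Definition relators (P : seq affine) S q0 h : seq (word * word) :=
  [:: (kappa ++ lamp h, lamp h ++ kappa);
      (zeta ++ start_lamp S q0 ++ kappa, kappa ++ start_lamp S q0)] ++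
  flatten [seq stable_relators i (nth (1, 0, (1, 0)) P i) | i <- iota 0 (size P)].

Definition wact (T : Type) (f : nat -> bool -> T -> T) (w : word) (x : T) : T :=
  foldr (fun l => f l.1 l.2) x w.

Section Action.
Variables (T : Type) (f : nat -> bool -> T -> T).
Hypothesis fK : forall i b, cancel (f i b) (f i (~~ b)).

Lemma wact_cat u v x : wact f (u ++ v) x = wact f u (wact f v x).
Proof. by rewrite /wact foldr_cat. Qed.

Lemma wact_inv w : cancel (wact f w) (wact f (winv w)).
Proof.
elim: w => [//|[i b] w IH] x.
by rewrite /winv /= rev_cons -cats1 wact_cat /= fK; apply: IH.
Qed.

Lemma wact_inv_eq u v : wact f u =1 wact f v -> wact f (winv u) =1 wact f (winv v).
Proof.
move=> E x.
by rewrite -{1}[x](wact_inv (winv v)) winvK -E wact_inv.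
Qed.
End Action.

Section Swap.
Variable T : eqType.

Definition swap (a b x : T) := if x == a then b else if x == b then a else x.

Lemma swapK a b : involutive (swap a b).
Proof.
move=> x; rewrite [swap a b x]/swap; case: (x =P a) => [->|/eqP xa].
  by rewrite /swap eqxx; case: eqP.
case: (x =P b) xa => [->|/eqP xb] xa; last by rewrite /swap (negPf xa) (negPf xb).
by rewrite /swap eqxx.
Qed.

Lemma swap_eqr a b x : (swap a b x == b) = (x == a).
Proof.
rewrite /swap; case: (x =P a) => [_|/eqP xa]; first by rewrite eqxx.
by case: (x =P b) xa => [->|/eqP/negPf xb] /negPf; rewrite ?xb // eq_sym.
Qed.
End Swap.

Section Model.
Local Open Scope ring_scope.

Definition ap (g : rat * rat) s := g.1 * s + g.2.
Definition acomp (f g : rat * rat) := (f.1 * g.1, f.1 * g.2 + f.2).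
Definition ainv (f : rat * rat) := (f.1^-1, - (f.1^-1 * f.2)).
Definition aid : rat * rat := (1, 0).

Lemma ap_comp f g s : ap (acomp f g) s = ap f (ap g s).
Proof. by rewrite /ap /=; ring. Qed.

Lemma acomp1 f : acomp f aid = f.
Proof. by case: f => a b; rewrite /acomp /= mulr1 mulr0 add0r. Qed.

Lemma apK f : f.1 != 0 -> cancel (ap f) (ap (ainv f)).
Proof. by move=> f0 s; rewrite /ap /=; field. Qed.

Lemma apVK f : f.1 != 0 -> cancel (ap (ainv f)) (ap f).
Proof. by move=> f0 s; rewrite /ap /=; field. Qed.

Lemma acompK f : f.1 != 0 -> cancel (acomp f) (acomp (ainv f)).
Proof. by move=> f0 [a b]; rewrite /acomp /=; congr pair; field. Qed.

Lemma acompVK f : f.1 != 0 -> cancel (acomp (ainv f)) (acomp f).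
Proof. by move=> f0 [a b]; rewrite /acomp /=; congr pair; field. Qed.

(* A point is (position, sheet, fibre coordinate).  On the sheet g the marked positions
   form the image of C under g.  The letter x translates positions, a stable letter acts
   by the total affine map extending its partial map, and kappa permutes the fibres over
   unmarked positions. *)
Definition point := (rat * (rat * rat) * nat)%type.

Definition shift (n : rat) (w : point) : point := (w.1.1 + n, w.1.2, w.2).

(** Action of the lamp at [n], confined to the base sheet. Its swap shares the coordinate 1 with
    that of [twist], so the two fail to commute over an unmarked point. *)
Definition toggle (n : rat) (w : point) : point :=
  (w.1, if w.1 == (n, aid) then swap 0%N 1%N w.2 else w.2).

Definition marked (C : nat -> Prop) s g := exists2 n, C n & s = ap g n%:R.

Definition twist (C : nat -> Prop) (w : point) : point :=
  (w.1, if excluded_middle_informative (marked C w.1.1 w.1.2) then w.2 else swap 1%N 2%N w.2).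

Definition slope (I : affine) : rat * rat :=
  let f := I.2.1%:R / I.1.1%:R in (f, I.2.2%:R - f * I.1.2%:R).

Definition in_class (I : affine) (s : rat) := (s - I.1.2%:R) / I.1.1%:R \is a Num.int.

(* On the domain of the partial map, the transposition of sheets brings the base sheet
   [aid] back to itself; this preserves marks because C is invariant. *)
Definition fix_base I s g := if in_class I s then swap (slope I) aid g else g.

Definition hnn I (b : bool) (w : point) : point :=
  if b then
    let s := ap (ainv (slope I)) w.1.1 in
    (s, acomp (ainv (slope I)) (fix_base I s w.1.2), w.2)
  else (ap (slope I) w.1.1, fix_base I w.1.1 (acomp (slope I) w.1.2), w.2).

(** The relator of zeta forces it to act as the commutator of the involutions [twist C] and
    [toggle n]. *)
Definition interp (P : seq affine) C K S q0 (i : nat) (b : bool) : point -> point :=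
  let n : rat := (S * K + q0)%N%:R in
  match i with
  | 0 => if b then toggle n \o twist C \o toggle n \o twist C
         else twist C \o toggle n \o twist C \o toggle n
  | 1 => shift (if b then -1 else 1)
  | 2 => toggle 0
  | 3 => twist C
  | 4 => shift (if b then - K%:R else K%:R)
  | i.+4.+1 => hnn (nth (1, 0, (1, 0))%N P i) b
  end.

Lemma toggleK n : involutive (toggle n).
Proof. by move=> [w j]; rewrite /toggle /=; case: eqP => //= ->; rewrite swapK. Qed.

Lemma twistK C : involutive (twist C).
Proof.
by move=> [w j]; rewrite /twist /=; case: excluded_middle_informative => //= _; rewrite swapK.
Qed.

Lemma shiftK n : cancel (shift n) (shift (- n)).
Proof. by move=> [[s g] j]; rewrite /shift /= addrK. Qed.

Lemma fix_baseK I s : involutive (fix_base I s).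
Proof. by move=> g; rewrite /fix_base; case: (in_class I s); rewrite ?swapK. Qed.

Lemma hnnK I b : (0 < I.1.1)%N -> (0 < I.2.1)%N -> cancel (hnn I b) (hnn I (~~ b)).
Proof.
move=> m0 m0'; have f0 : (slope I).1 != 0.
  by rewrite /= mulf_neq0 ?invr_neq0 // pnatr_eq0 -lt0n.
move=> [[s g] j]; case: b; rewrite /hnn /=.
  by rewrite acompVK // apVK // fix_baseK.
by rewrite apK // fix_baseK acompK.
Qed.

Section Verify.
Variables (P : seq affine) (C : nat -> Prop) (K S q0 h : nat).
Hypothesis HP : {in P, forall I, (I.1.2 < I.1.1 /\ I.2.2 < I.2.1)%N}.
Hypothesis HC : affine_invariant P C.
Hypothesis Hh : C h.
Hypothesis Hstart : ~ C (S * K + q0)%N.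
Let f := interp P C K S q0.

(** The default map has moduli 1, so letters beyond the list also act by permutations. *)
Lemma nth_affine_gt0 i : let I := nth (1, 0, (1, 0))%N P i in (0 < I.1.1 /\ 0 < I.2.1)%N.
Proof.
case: (ltnP i (size P)) => Hi; last by rewrite nth_default.
have [H1 H2] := HP (mem_nth (1, 0, (1, 0))%N Hi).
by split; [apply: leq_ltn_trans H1|apply: leq_ltn_trans H2].
Qed.

Lemma modulus_neq0 I : I \in P -> I.1.1%:R != 0 :> rat.
Proof. by move=> /HP[H _]; rewrite pnatr_eq0 -lt0n (leq_ltn_trans _ H). Qed.

Lemma slope_neq0 I : I \in P -> (slope I).1 != 0.
Proof.
move=> IP; have [_ H] := HP IP; rewrite /= mulf_neq0 ?invr_neq0 ?modulus_neq0 //.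
by rewrite pnatr_eq0 -lt0n (leq_ltn_trans _ H).
Qed.

Lemma interpK i b : cancel (f i b) (f i (~~ b)).
Proof.
case: i => [|[|[|[|[|i]]]]] x /=.
- by case: b => /=; rewrite !(twistK, toggleK).
- by case: b => /=; rewrite ?shiftK // -{1}[1]opprK shiftK.
- exact: toggleK.
- exact: twistK.
- by case: b => /=; rewrite ?shiftK // -{1}[K%:R]opprK shiftK.
- by have [? ?] := nth_affine_gt0 i; apply: hnnK.
Qed.

Lemma wact_pow1 n w : wact f (pow 1 n) w = shift n%:R w.
Proof.
elim: n => [|n IH]; first by case: w => [[s g] j]; rewrite /shift /= addr0.
by rewrite [LHS]/= -/(wact _ _) IH /shift /= -addrA natr1.
Qed.

Lemma wact_pow4 n w : wact f (pow 4 n) w = shift (n * K)%N%:R w.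
Proof.
elim: n => [|n IH]; first by case: w => [[s g] j]; rewrite /shift /= addr0.
by rewrite [LHS]/= -/(wact _ _) IH /shift /= -addrA -natrD mulSnr.
Qed.

Lemma wact_conj_tee u n : wact f u =1 shift n -> wact f (conjw u tee) =1 toggle n.
Proof.
move=> Hu w; rewrite /conjw !wact_cat Hu /=.
have -> : wact f (winv u) w = shift (- n) w.
  rewrite -{1}[w](shiftK (- n)) opprK -Hu wact_inv //; exact: interpK.
by case: w => [[s g] j]; rewrite /shift /toggle /= subrK !xpair_eqE subr_eq0.
Qed.

Lemma wact_lamp n : wact f (lamp n) =1 toggle n%:R.
Proof. exact/wact_conj_tee/wact_pow1. Qed.

Lemma wact_start_lamp : wact f (start_lamp S q0) =1 toggle (S * K + q0)%N%:R.
Proof.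
apply: wact_conj_tee => w; rewrite wact_cat wact_pow1 wact_pow4 /shift /=.
by rewrite -addrA -natrD addnC.
Qed.

Lemma twist_toggle n w : C n -> twist C (toggle n%:R w) = toggle n%:R (twist C w).
Proof.
move=> Cn; rewrite /twist /toggle /=; case: eqP => // -> /=.
case: excluded_middle_informative => // -[]; exists n => //.
by rewrite /ap /= mul1r addr0.
Qed.

Lemma marked_ap I s g : (slope I).1 != 0 ->
  marked C (ap (slope I) s) (acomp (slope I) g) <-> marked C s g.
Proof.
move=> f0; split=> -[n Cn E]; exists n => //; last by rewrite ap_comp E.
by apply: (can_inj (apK f0)); rewrite -ap_comp.
Qed.

Lemma ap_slope (I : affine) u : I.1.1%:R != 0 :> rat ->
  ap (slope I) (u * I.1.1%:R + I.1.2%:R) = u * I.2.1%:R + I.2.2%:R.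
Proof. by move=> m0; rewrite /ap /=; field. Qed.

(** Write [s = u m + a] with [u] an integer. Since [a < m] and [c < m'], both [s] and its image are
    natural exactly when [u] is nonnegative, and then the invariance of [C] applies. *)
Lemma marked_base I s : I \in P -> in_class I s ->
  marked C s aid <-> marked C (ap (slope I) s) aid.
Proof.
case: I => [[m a] [m' c]] IP; have [/= am cm] := HP IP.
have m0 : m%:R != 0 :> rat by rewrite pnatr_eq0; lia.
rewrite /in_class /= => /intrP[u Eu].
have -> : s = u%:~R * m%:R + a%:R by rewrite -Eu; field.
rewrite ap_slope //=.
have apid n : ap aid n%:R = n%:R by rewrite /ap /= mul1r addr0.
have uge0 b d n : (d < b)%N -> u%:~R * b%:R + d%:R = ap aid n%:R :> rat ->
    exists2 v : nat, u = v & n = (v * b + d)%N.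
  move=> db; rewrite apid => E.
  have {}E : u * b%:Z + d%:Z = n%:Z by apply: (@intr_inj rat); rewrite rmorphD rmorphM.
  by exists `|u|%N; nia.
split=> -[n Cn E].
- have [v Ev En] := uge0 _ _ _ am E; exists (v * m' + c)%N.
    by apply/(HC IP); rewrite -En.
  by rewrite apid Ev natrD natrM.
- have [v Ev En] := uge0 _ _ _ cm E; exists (v * m + a)%N.
    by apply/(HC IP); rewrite -En.
  by rewrite apid Ev natrD natrM.
Qed.

(** Only the sheets [slope I] and [aid] are exchanged, and over [ap (slope I) s] either is marked
    exactly when [s] is marked on [aid]. *)
Lemma marked_fix_base I s g : I \in P ->
  marked C (ap (slope I) s) (fix_base I s g) <-> marked C (ap (slope I) s) g.
Proof.
move=> IP; have [am cm] := HP IP; rewrite /fix_base; case: ifP => // Hs.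
have f0 := slope_neq0 IP.
have := marked_base IP Hs; have := marked_ap s aid f0; rewrite acomp1 => E1 E2.
by rewrite /swap; case: eqP => [->|_]; [|case: eqP => [->|//]]; tauto.
Qed.

Lemma twist_hnn I w : I \in P -> twist C (hnn I false w) = hnn I false (twist C w).
Proof.
move=> IP; have [am cm] := HP IP; rewrite /hnn /twist /=.
have f0 := slope_neq0 IP.
have H1 := marked_ap w.1.1 w.1.2 f0.
have H2 := marked_fix_base w.1.1 (acomp (slope I) w.1.2) IP.
case: excluded_middle_informative => H3; case: excluded_middle_informative => H4 //.
- by case: H4; apply/H1/H2.
- by case: H3; apply/H2/H1.
Qed.

Lemma hnn_shift I w : I \in P ->
  hnn I false (shift I.1.1%:R w) = shift I.2.1%:R (hnn I false w).
Proof.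
move=> IP; have [am cm] := HP IP.
have m0 := modulus_neq0 IP.
rewrite /hnn /shift /=; congr (_, _, _); first by rewrite /ap /=; field.
rewrite /fix_base; congr (if _ then _ else _); rewrite /in_class addrAC mulrDl divff //.
by rewrite rpredDr ?rpred1.
Qed.

(** Over position [a] the base sheet is carried to the sheet [slope I], which [fix_base] brings
    back, so the lamp at [a] goes to the lamp at [c]. *)
Lemma hnn_toggle I w : I \in P ->
  hnn I false (toggle I.1.2%:R w) = toggle I.2.2%:R (hnn I false w).
Proof.
move=> IP; have [am cm] := HP IP.
have m0 := modulus_neq0 IP.
have f0 := slope_neq0 IP.
have apa : ap (slope I) I.1.2%:R = I.2.2%:R.
  by have := ap_slope 0 m0; rewrite !mul0r !add0r.
rewrite /hnn /toggle /=; congr (_, _, if _ then _ else _).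
case: w => [[s g] j] /=; rewrite !xpair_eqE -apa (inj_eq (can_inj (apK f0))).
case: eqP => //= ->; rewrite /fix_base /in_class subrr mul0r rpred0 swap_eqr.
by rewrite -{2}(acomp1 (slope I)) (inj_eq (can_inj (acompK f0))).
Qed.

Lemma interp_relators u v : (u, v) \in relators P S q0 h -> wact f u =1 wact f v.
Proof.
have Hh1 w : wact f (kappa ++ lamp h) w = wact f (lamp h ++ kappa) w.
  by rewrite [LHS]wact_cat [RHS]wact_cat !wact_lamp; apply: twist_toggle.
have Hz w : wact f (zeta ++ start_lamp S q0 ++ kappa) w = wact f (kappa ++ start_lamp S q0) w.
  rewrite [LHS]wact_cat [X in wact f zeta X]wact_cat [RHS]wact_cat !wact_start_lamp /=.
  by rewrite toggleK twistK.
rewrite mem_cat !inE -orbA => /or3P[/eqP[-> ->]|/eqP[-> ->]|/flattenP[_ /mapP[i Hi ->]]] //.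
have {Hi} iP : (i < size P)%N by rewrite mem_iota in Hi.
have := mem_nth (1, 0, (1, 0))%N iP; set I := nth _ _ _ => IP.
have r1 w : wact f (stable i ++ pow 1 I.1.1) w = wact f (pow 1 I.2.1 ++ stable i) w.
  by rewrite [LHS]wact_cat [RHS]wact_cat !wact_pow1; apply: hnn_shift.
have r2 w : wact f (stable i ++ lamp I.1.2) w = wact f (lamp I.2.2 ++ stable i) w.
  by rewrite [LHS]wact_cat [RHS]wact_cat !wact_lamp; apply: hnn_toggle.
have r3 w : wact f (kappa ++ stable i) w = wact f (stable i ++ kappa) w.
  exact: twist_hnn.
rewrite /stable_relators 2!in_cons mem_seq1 => /or3P[] /eqP E;
  by rewrite (congr1 fst E : u = _) (congr1 snd E : v = _).
Qed.

Lemma interp_input : wact f (pow 1 K) =1 wact f (gen 4).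
Proof. by move=> w; rewrite wact_pow1. Qed.

Lemma interp_zeta : exists w, f 0%N false w <> w.
Proof.
set al : rat := (S * K + q0)%N%:R.
have Ht j : toggle al (al, aid, j) = (al, aid, swap 0%N 1%N j) by rewrite /toggle eqxx.
have Hk j : twist C (al, aid, j) = (al, aid, swap 1%N 2%N j).
  rewrite /twist /=; case: excluded_middle_informative => // -[n Cn E]; case: Hstart; move: E.
  by rewrite /al /ap /= mul1r addr0 => /eqP; rewrite eqr_nat => /eqP->.
(* The start point is unmarked, so toggle, twist, toggle, twist take the coordinate 0 to 1, 2, 2, 1
   in turn. *)
exists (al, aid, 0%N).
suff -> : f 0%N false (al, aid, 0%N) = (al, aid, 1%N) by [].
exact: etrans (congr1 _ (congr1 _ (etrans (congr1 _ (Ht 0%N)) (Hk _))))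
  (etrans (congr1 _ (Ht _)) (Hk _)).
Qed.
End Verify.
End Model.

Lemma relators_model P C K S q0 h :
  {in P, forall I, (I.1.2 < I.1.1 /\ I.2.2 < I.2.1)%N} -> affine_invariant P C -> C h ->
  ~ C (S * K + q0) ->
  exists T (f : nat -> bool -> T -> T), [/\ forall i b, cancel (f i b) (f i (~~ b)),
    forall u v, (u, v) \in (pow 1 K, gen 4) :: relators P S q0 h -> wact f u =1 wact f v &
    exists x, wact f zeta x <> x].
Proof.
move=> HP HC Hh HS; exists point, (interp P C K S q0); split.
- exact: interpK.
- move=> u v; rewrite inE => /orP[/eqP[-> ->]|]; first exact: interp_input.
  exact: interp_relators.
- exact: interp_zeta.
Qed.

(** * Deriving the halting relation *)

Lemma winv_cat u v : winv (u ++ v) = winv v ++ winv u.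
Proof. by rewrite /winv map_cat rev_cat. Qed.

Lemma powD i m n : pow i (m + n) = pow i m ++ pow i n.
Proof. exact: nseqD. Qed.

Lemma lampD n a : lamp (n + a) = conjw (pow 1 n) (lamp a).
Proof. by rewrite /lamp /conjw powD winv_cat !catA. Qed.

(** The laws of equality in a quotient of the free group. Keeping the relation abstract allows
    membership in the Mihailova subgroup to take its place. *)
Record congruence (eqv : word -> word -> Prop) : Prop := Congruence {
  cong_refl : forall u, eqv u u;
  cong_sym : forall u v, eqv u v -> eqv v u;
  cong_trans : forall v u w, eqv u v -> eqv v w -> eqv u w;
  cong_cat : forall u u' v v', eqv u u' -> eqv v v' -> eqv (u ++ v) (u' ++ v');
  cong_invr : forall u, eqv (u ++ winv u) [::];
  cong_invl : forall u, eqv (winv u ++ u) [::] }.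

Section Derivation.
Variable eqv : word -> word -> Prop.
Hypothesis Heqv : congruence eqv.

Let refl := cong_refl Heqv.
Let sym := cong_sym Heqv.
Let trans := cong_trans Heqv.
Let cat := cong_cat Heqv.
Let invr := cong_invr Heqv.
Let invl := cong_invl Heqv.

Lemma eqv_catl u v v' : eqv v v' -> eqv (u ++ v) (u ++ v').
Proof. exact: cat. Qed.

Lemma eqv_catr u u' v : eqv u u' -> eqv (u ++ v) (u' ++ v).
Proof. by move/cat; apply. Qed.

Lemma eqv_cancelr u v w : eqv (u ++ w) (v ++ w) -> eqv u v.
Proof.
have K x : eqv ((x ++ w) ++ winv w) x.
  rewrite -catA -[in X in eqv _ X](cats0 x); exact: eqv_catl.
by move=> /(@eqv_catr _ _ (winv w)) H; apply: trans (sym (K u)) (trans H (K v)).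
Qed.

Lemma eqv_cancell u v w : eqv (w ++ u) (w ++ v) -> eqv u v.
Proof.
have K x : eqv (winv w ++ w ++ x) x.
  by rewrite catA -[in X in eqv _ X](cat0s x); apply: eqv_catr.
by move=> /(@eqv_catl (winv w)) H; apply: trans (sym (K u)) (trans H (K v)).
Qed.

Lemma eqv_winv u v : eqv u v -> eqv (winv u) (winv v).
Proof.
move=> E; apply: (@eqv_cancelr _ _ u); apply: trans (invl u) _.
by apply: trans (sym (invl v)) _; apply/eqv_catl/sym.
Qed.

(** The common form of the stable relators and, for [u = v], of commutation with kappa. *)
Definition intertwines r u v := eqv (r ++ u) (v ++ r).

Lemma intertwines_nil r : intertwines r [::] [::].
Proof. by rewrite /intertwines cats0; apply: refl. Qed.

Lemma intertwines_cat r u u' v v' : intertwines r u v -> intertwines r u' v' ->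
  intertwines r (u ++ u') (v ++ v').
Proof.
rewrite /intertwines => E E'; rewrite catA.
by apply: trans (eqv_catr _ E) _; rewrite -!catA; apply: eqv_catl.
Qed.

Lemma intertwines_inv r u v : intertwines r u v -> intertwines r (winv u) (winv v).
Proof.
rewrite /intertwines => E; apply: (@eqv_cancell _ _ v); apply: (@eqv_cancelr _ _ u).
apply: (@trans (v ++ r)).
  rewrite -!catA; apply: eqv_catl; rewrite -[in X in eqv _ X](cats0 r).
  exact: eqv_catl.
apply: trans (sym E) _; rewrite !catA; apply: eqv_catr.
by apply: sym; rewrite -[in X in eqv _ X](cat0s r); apply: eqv_catr.
Qed.

Lemma intertwines_conj r u u' v v' : intertwines r u u' -> intertwines r v v' ->
  intertwines r (conjw u v) (conjw u' v').
Proof. by move=> Hu Hv; do !apply: intertwines_cat => //; apply: intertwines_inv. Qed.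

Lemma intertwines_pow r m m' u :
  intertwines r (pow 1 m) (pow 1 m') -> intertwines r (pow 1 (u * m)) (pow 1 (u * m')).
Proof.
move=> H; elim: u => [|u IH]; first exact: intertwines_nil.
by rewrite !mulSn !powD; apply: intertwines_cat.
Qed.

Lemma eqv_intertwines r u v : eqv u v -> intertwines r u u -> intertwines r v v.
Proof.
rewrite /intertwines => E H; apply: trans (eqv_catl _ (sym E)) _.
by apply: trans H _; apply: eqv_catr.
Qed.

(** [v] is the conjugate of [u] by [r], and [k] commutes with [r]. *)
Lemma intertwines_transfer k r u v : intertwines k r r -> intertwines r u v ->
  intertwines k u u <-> intertwines k v v.
Proof.
move=> Hr Huv; split=> H.
- apply: (@eqv_intertwines _ (conjw r u)); last exact: intertwines_conj.
  rewrite /conjw catA; apply: trans (eqv_catr _ Huv) _; rewrite -catA.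
  by rewrite -[in X in eqv _ X](cats0 v); apply: eqv_catl.
- apply: (@eqv_intertwines _ (winv r ++ v ++ r)).
    apply: trans (eqv_catl _ (sym Huv)) _; rewrite catA.
    by rewrite -[in X in eqv _ X](cat0s u); apply: eqv_catr.
  by do !apply: intertwines_cat => //; apply: intertwines_inv.
Qed.

Lemma eqv_pow i K n : eqv (pow 1 K) (gen i) -> eqv (pow 1 (n * K)) (pow i n).
Proof.
move=> E; elim: n => [|n IH]; first exact: refl.
by rewrite mulSn powD -[pow i n.+1]/(gen i ++ pow i n); apply: cat.
Qed.

Lemma relators_derive P S q0 h K :
  (forall u v, (u, v) \in (pow 1 K, gen 4) :: relators P S q0 h -> eqv u v) ->
  (forall C, affine_invariant P C -> C h -> C (S * K + q0)) ->
  eqv zeta [::].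
Proof.
move=> Hrel Hinv.
have Hh : intertwines kappa (lamp h) (lamp h) by apply: Hrel; rewrite !inE eqxx !orbT.
have Hz : eqv (zeta ++ start_lamp S q0 ++ kappa) (kappa ++ start_lamp S q0).
  by apply: Hrel; rewrite !inE eqxx !orbT.
have Hx : eqv (pow 1 K) (gen 4) by apply: Hrel; rewrite inE eqxx.
have : intertwines kappa (lamp (S * K + q0)) (lamp (S * K + q0)).
  (* The invariant set is that of all [n] whose lamp commutes with kappa. *)
  apply: (Hinv (fun n => intertwines kappa (lamp n) (lamp n))) Hh => m a m' c IP u.
  set i := index (m, a, (m', c)) P.
  have Hi j : j < 3 -> nth ([::], [::]) (stable_relators i (m, a, (m', c))) j
      \in (pow 1 K, gen 4) :: relators P S q0 h.
    move=> Hj; rewrite inE mem_cat; apply/orP; right; apply/orP; right; apply/flattenP.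
    exists (stable_relators i (m, a, (m', c))); last exact: mem_nth.
    by apply/mapP; exists i; rewrite ?mem_iota ?index_mem // nth_index.
  apply: (@intertwines_transfer _ (stable i)); first exact: Hrel (Hi 2 isT).
  rewrite !lampD; apply: intertwines_conj; last exact: Hrel (Hi 1 isT).
  exact/intertwines_pow/(Hrel _ _ (Hi 0 isT)).
(* The relation x^K = xi lets kappa commute with [start_lamp] too; the relator of zeta then cancels
   to zeta = 1. *)
move/(@eqv_intertwines _ _ (start_lamp S q0)) => Hk.
apply: (@eqv_cancelr _ _ (start_lamp S q0 ++ kappa)); apply: trans Hz _; apply: Hk.
have E : eqv (pow 1 (S * K + q0)) (pow 4 S ++ pow 1 q0).
  by rewrite powD; apply/eqv_catr/eqv_pow.
by apply: cat => //; apply: cat; [exact: refl|exact: eqv_winv].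
Qed.
End Derivation.

(** * A free family of transvections *)

Definition linv (l : nat * bool) := (l.1, ~~ l.2).

Definition push l (w : word) : word :=
  if w is l' :: w' then if l' == linv l then w' else l :: w else [:: l].

Definition reduce : word -> word := foldr push [::].

Definition reduced (w : word) := sorted (fun l l' => l' != linv l) w.

Lemma push_reduced l w : reduced w -> reduced (push l w).
Proof.
case: w => //= l' w Hw; case: ifP => [_|/negbT H]; first exact: path_sorted Hw.
by rewrite /reduced /= H.
Qed.

Lemma reduce_reduced w : reduced (reduce w).
Proof. by elim: w => //= l w; apply: push_reduced. Qed.

Lemma wact_reduce T (f : nat -> bool -> T -> T) w :
  (forall i b, cancel (f i b) (f i (~~ b))) -> wact f (reduce w) =1 wact f w.
Proof.
move=> fK; elim: w => // -[i b] w IH x /=; rewrite -IH.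
case: (reduce w) => //= -[i' b'] w'; case: eqP => //= -[-> ->].
by rewrite -{1}[b]negbK fK.
Qed.

Section PingPong.
Local Open Scope ring_scope.

Definition sgn (b : bool) : int := if b then -1 else 1.

(* The action on column vectors of the matrix [smx i 1] below, or of its inverse. *)
Definition transv (i : nat) (b : bool) (v : int * int) : int * int :=
  let z := v.2 - 6 * i%:Z * v.1 in (v.1 + sgn b * z, v.2 + 6 * i%:Z * (sgn b * z)).

(** A cone around the fixed direction (1, 6 i) of the transvection, on the side into which the
    letter pushes. *)
Definition domain (l : nat * bool) (v : int * int) :=
  let z := v.2 - 6 * l.1%:Z * v.1 in `|z| < 3 * `|v.1| /\ 0 < sgn l.2 * v.1 * z.

(** The fixed directions have slopes at least 6 apart, so [|z| < 3 |p|] for one index forces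
    [3 |p| < |y|] for another; after adding or subtracting [y] the first coordinate exceeds
    [2 |y| / 3]. *)
Lemma transv_domain_other i b j b' v : i <> j -> domain (j, b') v -> domain (i, b) (transv i b v).
Proof.
case: v => p q ij; rewrite /domain /transv /= => -[H1 H2].
set z := q - 6 * j%:Z * p in H1 H2; set y := q - 6 * i%:Z * p.
have Ey : y = z + 6 * ((j%:Z - i%:Z) * p) by rewrite /y /z; ring.
have Hd : `|p| <= `|(j%:Z - i%:Z) * p| by rewrite normrM ler_peMl //; lia.
have -> : q + 6 * i%:Z * (sgn b * y) - 6 * i%:Z * (p + sgn b * y) = y by rewrite /y; ring.
have {ij Hd Ey} Hy : 3 * `|p| < `|y| by lia.
have p0 : p != 0 by apply: contraTneq H2 => ->; rewrite mulr0 mul0r.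
by rewrite /sgn; case: b; split; nia.
Qed.

Lemma transv_domain_same i b v : domain (i, b) v -> domain (i, b) (transv i b v).
Proof.
case: v => p q; rewrite /domain /transv /=; set y := q - 6 * i%:Z * p => -[H1 H2].
have -> : q + 6 * i%:Z * (sgn b * y) - 6 * i%:Z * (p + sgn b * y) = y by rewrite /y; ring.
by move: H1 H2; rewrite /sgn; case: b; split; nia.
Qed.

(** Ping-pong from (0, 1), which lies in no domain but is sent by every letter into its own. *)
Lemma reduced_domain l w : reduced (l :: w) -> domain l (wact transv (l :: w) (0, 1)).
Proof.
elim: w l => [|l' w IH] [i b].
  by rewrite /domain /transv /= /sgn; case: b; split; lia.
rewrite -[wact _ _ _]/(transv i b (wact transv (l' :: w) (0, 1))) => /andP[ll' Hw].
have := IH _ Hw; move: (wact _ _ _) => v; case: l' ll' {IH Hw} => j b' ll'.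
have [ij|/eqP ij] := eqVneq i j; last exact: transv_domain_other.
move: ll'; rewrite -{}ij xpair_eqE eqxx /= => bb'.
have -> : b' = b by case: b b' bb' => -[].
exact: transv_domain_same.
Qed.

(* The identity plus k times the nilpotent matrix (1, 6 i)^T (-6 i, 1). *)
Definition smx (i : nat) (k : rat) : 'M[rat]_2 := \matrix_(r, c)
  if r == 0 then if c == 0 then 1 - 6 * i%:R * k else k
  else if c == 0 then - (36 * i%:R ^+ 2 * k) else 1 + 6 * i%:R * k.

Lemma mx2P (A B : 'M[rat]_2) :
  A 0 0 = B 0 0 -> A 0 1 = B 0 1 -> A 1 0 = B 1 0 -> A 1 1 = B 1 1 -> A = B.
Proof.
move=> H1 H2 H3 H4; apply/matrixP => i j.
have E (k : 'I_2) : k = 0 \/ k = 1 by case: k => -[|[|k]] //= Hk; [left|right]; apply: val_inj.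
by case: (E i) => ->; case: (E j) => ->.
Qed.

Lemma mulmx2E (A B : 'M[rat]_2) i j : (A *m B) i j = A i 0 * B 0 j + A i 1 * B 1 j.
Proof.
rewrite mxE !big_ord_recl big_ord0 addr0.
by congr (_ + A i _ * B _ j); apply: val_inj.
Qed.

(** The nilpotent part squares to zero. Powers of a letter thus have entries affine in the exponent,
    which keeps the input matrix computable. *)
Lemma smxD i k l : smx i k *m smx i l = smx i (k + l).
Proof. by apply: mx2P; rewrite mulmx2E !mxE /=; ring. Qed.

Lemma smx0 i : smx i 0 = 1.
Proof. by apply: mx2P; rewrite !mxE /= ?mulr0 ?subr0 ?addr0 ?oppr0. Qed.

Definition wmx (w : word) : 'M[rat]_2 := foldr (fun l M => smx l.1 (sgn l.2)%:~R *m M) 1 w.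

Lemma wmx_cat u v : wmx (u ++ v) = wmx u *m wmx v.
Proof. by elim: u => [|l u IH] /=; rewrite ?mul1mx // IH mulmxA. Qed.

Lemma wmx_invl w : wmx (winv w) *m wmx w = 1.
Proof.
elim: w => [|l w IH]; first by rewrite mul1mx.
rewrite /winv map_cons rev_cons -cats1 wmx_cat /= mulmxE mulr1 -mulrA.
rewrite [smx _ _ * (_ * _)]mulrA -[smx _ _ * smx _ _]/(smx _ _ *m smx _ _) smxD.
by rewrite -rmorphD; case: l.2; rewrite /= smx0 mul1r; apply: IH.
Qed.

Lemma wmx_invr w : wmx w *m wmx (winv w) = 1.
Proof. exact/mulmx1C/wmx_invl. Qed.

Lemma wmx_pow i n : wmx (pow i n) = smx i n%:R.
Proof. by elim: n => [|n IH]; rewrite ?smx0 //= IH smxD -natr1 addrC. Qed.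

Lemma wmx_reduce w : wmx (reduce w) = wmx w.
Proof.
elim: w => //= l w <-; case: (reduce w) => //= l' w'; case: eqP => //= ->.
rewrite mulmxA smxD -rmorphD /=.
by case: l.2; rewrite /= smx0 mul1mx.
Qed.

Lemma wmx_transv w : let v := wact transv w (0, 1) in
  wmx w 0 1 = v.1%:~R /\ wmx w 1 1 = v.2%:~R.
Proof.
elim: w => [|[i b] w [IH1 IH2]]; first by rewrite !mxE.
rewrite [wact _ _ _]/= [wmx _]/= !mulmx2E IH1 IH2 !mxE /=.
by move: (wact _ _ _) => v; rewrite /transv /=; split; ring.
Qed.

(** This entry is the first coordinate of the image of (0, 1), nonzero for a nonempty reduced word;
    so [w] reduces to the empty word. *)
Lemma wmx01_eq0 w T (f : nat -> bool -> T -> T) : wmx w 0 1 = 0 ->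
  (forall i b, cancel (f i b) (f i (~~ b))) -> wact f w =1 id.
Proof.
rewrite -wmx_reduce => H0 fK x; rewrite -(wact_reduce _ fK) //.
move: H0 (reduce_reduced w); case: (reduce w) => // l w' H0 Hw.
have := reduced_domain Hw; have [] := wmx_transv (l :: w'); rewrite H0 => /esym/eqP.
by rewrite intr_eq0 => /eqP E _ []; rewrite E !(mulr0, mul0r).
Qed.
End PingPong.

(** * The six-dimensional representation *)

Section Representation.
Local Open Scope ring_scope.

(* Symmetric square, in the basis e_0^2, e_0 e_1, e_1^2. *)
Definition sym2 (A : 'M[rat]_2) : 'M[rat]_3 := \matrix_(i, j)
  (nth [::] [::
    [:: A 0 0 * A 0 0; A 0 0 * A 0 1; A 0 1 * A 0 1];
    [:: 2 * (A 0 0 * A 1 0); A 0 0 * A 1 1 + A 0 1 * A 1 0; 2 * (A 0 1 * A 1 1)];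
    [:: A 1 0 * A 1 0; A 1 0 * A 1 1; A 1 1 * A 1 1]] i)`_j.

Lemma sym2M A B : sym2 (A *m B) = sym2 A *m sym2 B.
Proof.
apply/matrixP => -[[|[|[|i]]] Hi] // -[[|[|[|j]]] Hj] //;
  by rewrite [LHS]mxE [RHS]mxE /= !mulmx2E !big_ord_recl big_ord0 !mxE /=; ring.
Qed.

Lemma sym2_1 : sym2 1%:M = 1%:M.
Proof.
by apply/matrixP => -[[|[|[|i]]] Hi] // -[[|[|[|j]]] Hj] //; rewrite !mxE /=; ring.
Qed.

(* Conjugation of B by [[1, 0], [1, 1]]: its corner is B 0 0 + B 0 1. *)
Definition shear (e : rat) : 'M[rat]_2 := \matrix_(i, j)
  if i == 0 then (j == 0)%:R else if j == 0 then e else 1.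

Definition conj_shear (B : 'M[rat]_2) := shear (- 1) *m B *m shear 1.

Lemma shearK : shear 1 *m shear (- 1) = 1%:M.
Proof. by apply: mx2P; rewrite mulmx2E !mxE /=; ring. Qed.

Lemma conj_shearM A B : conj_shear (A *m B) = conj_shear A *m conj_shear B.
Proof.
by rewrite /conj_shear !mulmxA -[_ *m shear 1 *m shear (- 1)]mulmxA shearK mulmx1.
Qed.

Variable m : nat.
Notation n := (3 + (3 + m))%N.

Definition link : 'M[rat]_(3 + m, 3) := col_mx (delta_mx 2 0) 0.
Definition colink : 'M[rat]_(3, 3 + m) := row_mx (delta_mx 0 0) 0.
Definition lower E : 'M[rat]_n := block_mx 1%:M 0 E 1%:M.
Definition upper F : 'M[rat]_n := block_mx 1%:M F 0 1%:M.

Lemma lowerK E : lower E *m lower (- E) = 1%:M.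
Proof.
rewrite /lower mulmx_block !(mul1mx, mulmx1, mul0mx, mulmx0, addr0, add0r) subrr.
by rewrite -scalar_mx_block.
Qed.

Lemma upperK F : upper F *m upper (- F) = 1%:M.
Proof.
rewrite /upper mulmx_block !(mul1mx, mulmx1, mul0mx, mulmx0, addr0, add0r) addNr.
by rewrite -scalar_mx_block.
Qed.

(** The identity block of size [m] pads dimension 6 up to the required one. *)
Definition diag2 (A B : 'M[rat]_2) : 'M[rat]_n :=
  block_mx (sym2 (conj_shear B)) 0 0 (block_mx (sym2 A) 0 0 1%:M).

(** With basis e for the block of [B] and f for that of [A], the conjugating matrix has first row
    e_0 + f_0 and its inverse has first column e_0 + f_2. The corner thus adds the (0, 0) entry of
    the first block to the (0, 2) entry of [sym2 A]. *)
Definition Phi (A B : 'M[rat]_2) : 'M[rat]_n :=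
  upper colink *m lower (- link) *m diag2 A B *m (lower link *m upper (- colink)).

Lemma PhiM A A' B B' : Phi (A *m A') (B *m B') = Phi A B *m Phi A' B'.
Proof.
have H : lower link *m upper (- colink) *m (upper colink *m lower (- link)) = 1%:M.
  by rewrite mulmxA -[_ *m upper _ *m upper _]mulmxA (mulmx1C (upperK _)) mulmx1 lowerK.
rewrite /Phi; have -> : diag2 (A *m A') (B *m B') = diag2 A B *m diag2 A' B'.
  rewrite /diag2 !mulmx_block !(mul1mx, mulmx1, mul0mx, mulmx0, addr0, add0r).
  by rewrite conj_shearM !sym2M.
move: H; set X := lower link *m _; set Y := upper colink *m _ => H.
clearbody X Y.
by rewrite !mulmxA -[_ *m X *m Y]mulmxA H mulmx1.
Qed.

Lemma Phi1 : Phi 1 1 = 1%:M.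
Proof.
rewrite /Phi; have -> : diag2 1 1 = 1%:M.
  rewrite /diag2 /conj_shear mulmx1 (mulmx1C shearK) sym2_1 -scalar_mx_block.
  by rewrite -scalar_mx_block.
rewrite mulmx1 mulmxA -[_ *m lower link]mulmxA.
by rewrite (mulmx1C (lowerK _)) mulmx1 upperK.
Qed.

Lemma Phi_corner A B i j : val i = 0%N -> val j = 0%N ->
  Phi A B i j = A 0 1 ^+ 2 + (B 0 0 + B 0 1) ^+ 2.
Proof.
move=> i0 j0; have -> : i = lshift (3 + m) (0 : 'I_3) by apply: val_inj.
have -> : j = lshift (3 + m) (0 : 'I_3) by apply: val_inj.
rewrite /Phi /upper /lower /diag2 !mulmx_block.
rewrite !(mul1mx, mulmx1, mul0mx, mulmx0, addr0, add0r).
rewrite block_mxEul /colink /link mulmxN mul_row_col mul_delta_mx_0 // mulmx0 addr0 oppr0 addr0.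
rewrite mul1mx mul_row_block !(mulmx0, mul0mx, addr0) mul_row_col !(mulmx0, mul0mx, addr0).
rewrite mxE addrC; congr (_ + _).
  by rewrite mxE !big_ord_recl big_ord0 !mxE !big_ord_recl !big_ord0 !mxE /=; ring.
by rewrite mxE /= /conj_shear !mulmx2E !mxE /=; ring.
Qed.
End Representation.

Section ComputableRepresentation.
Local Open Scope ring_scope.

Lemma computableMx_sym2 A : computableMx A -> computableMx (fun k => sym2 (A k)).
Proof.
move=> HA; apply: computableMx_fun => -[i Hi] [j Hj] /=.
have H2 := computableZ_const 2.
by case: i Hi => [|[|[|i]]] // _; case: j Hj => [|[|[|j]]] //= _;
  do ?[exact: HA|exact: H2|apply: computableZ_add|apply: computableZ_mul].
Qed.

Lemma computableMx_shear a b : computableMx (fun=> shear (a%:R - b%:R)).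
Proof.
apply: computableMx_fun => i j; case: ifP => _; first exact: computableZ_const.
case: ifP => _; last exact: computableZ_const 1.
by apply: computableZ_sub; apply: computableZ_const.
Qed.

Lemma computableMx_Phi m A B : computableMx A -> computableMx B ->
  computableMx (fun k => Phi m (A k) (B k)).
Proof.
move=> HA HB.
have H1 := computableMx_shear 0 1; have H2 := computableMx_shear 1 0.
rewrite sub0r in H1; rewrite subr0 in H2.
have Hb : computableMx (fun k => sym2 (conj_shear (B k))).
  by apply: computableMx_sym2; do !apply: computableMx_mul.
do !apply: computableMx_mul; do ?apply: computableMx_block; do ?apply: computableMx_opp;
  do ?[exact: computableMx0|exact: computableMx1|exact: computableMx_sym2|exact: Hb];
  rewrite /link /colink; do ?apply: computableMx_opp;
  by [apply: computableMx_row_mx; [exact: computableMx_delta|exact: computableMx0]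
     |apply: computableMx_col_mx; [exact: computableMx_delta|exact: computableMx0]].
Qed.

Lemma computableMx_smx i f : computable1 f -> computableMx (fun k => smx i (f k)%:R).
Proof.
move=> /computableZ_nat Hf; apply: computableMx_fun => r c.
have Hc := computableZ_const.
have H1 : computableZ (fun=> 1) := Hc 1%N.
have Hif : computableZ (fun k => 6 * i%:R * (f k)%:R).
  by do 2 apply: computableZ_mul => //; apply: Hc.
case: (r == 0); case: (c == 0) => //=.
- exact: computableZ_sub.
- apply/computableZ_opp/computableZ_mul => //.
  exact: computableZ_mul (Hc 36%N) (computableZ_mul (Hc i) (Hc i)).
- exact: computableZ_add.
Qed.
End ComputableRepresentation.

Opaque Phi.

(** * Subgroups generated by pairs of words *)

Definition pair_mx m (p : word * word) := Phi m (wmx p.1) (wmx p.2).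

Section Subgroup.
Local Open Scope ring_scope.
Variables (m : nat) (R : seq (word * word)).
Notation X := [seq pair_mx m p | p <- R].

Lemma pair_mxM u v u' v' :
  pair_mx m (u ++ u', v ++ v') = pair_mx m (u, v) *m pair_mx m (u', v').
Proof. by rewrite /pair_mx !wmx_cat PhiM. Qed.

Lemma pair_mx_inv u v : pair_mx m (u, v) *m pair_mx m (winv u, winv v) = 1%:M.
Proof. by rewrite -pair_mxM /pair_mx /= !wmx_cat !wmx_invr Phi1. Qed.

Lemma pair_mx_unit u v : pair_mx m (u, v) \in unitmx.
Proof. by have [] := mulmx1_unit (pair_mx_inv u v). Qed.

Lemma invmx_pair u v : invmx (pair_mx m (u, v)) = pair_mx m (winv u, winv v).
Proof.
by rewrite -[LHS]mulmx1 -(pair_mx_inv u v) mulKmx // pair_mx_unit.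
Qed.

Lemma in_gen_group_mul A B : in_gen_group X A -> in_gen_group X B -> in_gen_group X (A *m B).
Proof.
by elim=> [|A1 A2 H1 _ IH /IH|A1 A2 H1 _ IH /IH]; rewrite ?mul1mx // -mulmxA; constructor.
Qed.

Lemma in_gen_group_gen p : p \in R -> in_gen_group X (pair_mx m p).
Proof.
move=> pR; rewrite -[pair_mx m p]mulmx1; apply: gen_mul; last exact: gen_one.
exact: map_f.
Qed.

(** Induction over products of generators, tracking words that agree in every model of the
    relations. Inverses are carried along because [in_gen_group] inverts generators only. *)
Lemma in_gen_group_words A : in_gen_group X A -> exists u v, [/\ A = pair_mx m (u, v),
  in_gen_group X (pair_mx m (winv u, winv v)) &
  forall T (f : nat -> bool -> T -> T), (forall i b, cancel (f i b) (f i (~~ b))) ->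
    (forall u v, (u, v) \in R -> wact f u =1 wact f v) -> wact f u =1 wact f v].
Proof.
elim=> [|_ _ /mapP[[u v] uvR ->] _ [u' [v' [-> IH1 IH2]]]
       |_ _ /mapP[[u v] uvR ->] _ [u' [v' [-> IH1 IH2]]]].
- exists [::], [::]; split=> //; first by rewrite /pair_mx Phi1.
  by rewrite /pair_mx /= Phi1; apply: gen_one.
- exists (u ++ u'), (v ++ v'); split; first by rewrite pair_mxM.
    rewrite !winv_cat pair_mxM; apply: in_gen_group_mul => //.
    rewrite -[pair_mx _ _]mulmx1 -invmx_pair; apply: gen_mulinv; last exact: gen_one.
    exact: map_f.
  by move=> T f fK fR x; rewrite !wact_cat (IH2 T f) // (fR u v).
- exists (winv u ++ u'), (winv v ++ v'); split; first by rewrite pair_mxM invmx_pair.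
    rewrite !winv_cat pair_mxM !winvK; apply: in_gen_group_mul => //.
    exact: in_gen_group_gen.
  by move=> T f fK fR x; rewrite !wact_cat (IH2 T f) // (wact_inv_eq fK (fR u v uvR)).
Qed.

Lemma in_gen_group_inv u v :
  in_gen_group X (pair_mx m (u, v)) -> in_gen_group X (pair_mx m (winv u, winv v)).
Proof.
by move=> /in_gen_group_words[u' [v' [E H _]]]; rewrite -invmx_pair E invmx_pair.
Qed.

(* Reflexivity of the congruence below needs a generator for each letter; only those
   below L have one, so the others are erased. *)
Definition erase L (w : word) : word := [seq l <- w | l.1 < L]%N.

Lemma erase_cat L u v : erase L (u ++ v) = erase L u ++ erase L v.
Proof. exact: filter_cat. Qed.

Lemma erase_winv L w : erase L (winv w) = winv (erase L w).
Proof. by rewrite /erase /winv filter_rev filter_map. Qed.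

(** The subgroup contains the diagonal; then (v, v) (u, v)^-1 (u, u) = (v, u) gives symmetry and (u,
    v) (v, v)^-1 (v, w) = (u, w) transitivity. *)
Lemma in_gen_group_congruence L :
  {in iota 0 L, forall i, (gen i, gen i) \in R} ->
  congruence (fun u v => in_gen_group X (pair_mx m (erase L u, erase L v))).
Proof.
move=> HL.
have Hrefl u : in_gen_group X (pair_mx m (erase L u, erase L u)).
  elim: u => [|[i b] u IH]; first by rewrite /pair_mx Phi1; apply: gen_one.
  rewrite /erase /=; case: ifP => // Hi.
  have Hg : in_gen_group X (pair_mx m (gen i, gen i)).
    by apply/in_gen_group_gen/HL; rewrite mem_iota.
  rewrite -/(erase L u) -/(cat [:: (i, b)] (erase L u)).
  rewrite (pair_mxM [:: (i, b)] [:: (i, b)] (erase L u) (erase L u)).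
  apply: in_gen_group_mul IH; case: b; [exact: (in_gen_group_inv Hg)|exact: Hg].
have Hcat u u' v v' : in_gen_group X (pair_mx m (erase L u, erase L u')) ->
    in_gen_group X (pair_mx m (erase L v, erase L v')) ->
    in_gen_group X (pair_mx m (erase L (u ++ v), erase L (u' ++ v'))).
  by rewrite !erase_cat pair_mxM; apply: in_gen_group_mul.
have E u v u' v' : wmx u = wmx u' -> wmx v = wmx v' -> pair_mx m (u, v) = pair_mx m (u', v').
  by rewrite /pair_mx => -> ->.
have Hsym u v : in_gen_group X (pair_mx m (erase L u, erase L v)) ->
    in_gen_group X (pair_mx m (erase L v, erase L u)).
  move=> /in_gen_group_inv; rewrite -!erase_winv => /(Hcat _ _ _ _ (Hrefl v)).
  move=> /Hcat /(_ (Hrefl u)); congr (in_gen_group _ _); apply: E.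
    by rewrite !erase_cat erase_winv !wmx_cat -mulmxA wmx_invl mulmx1.
  by rewrite !erase_cat erase_winv !wmx_cat wmx_invr mul1mx.
split=> //.
- move=> v u w Huv Hvw; have := Hcat _ _ _ _ (Hcat _ _ _ _ Huv (Hrefl (winv v))) Hvw.
  congr (in_gen_group _ _); apply: E.
    by rewrite !erase_cat erase_winv !wmx_cat -mulmxA wmx_invl mulmx1.
  by rewrite !erase_cat erase_winv !wmx_cat wmx_invr mul1mx.
- move=> u; have := Hrefl [::]; congr (in_gen_group _ _); apply: E => //.
  by rewrite erase_cat erase_winv wmx_cat wmx_invr.
- move=> u; have := Hrefl [::]; congr (in_gen_group _ _); apply: E => //.
  by rewrite erase_cat erase_winv wmx_cat wmx_invl.
Qed.
End Subgroup.

(** The first list generates the diagonal over the five fixed letters and one stable letter per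
    map. *)
Definition mihailova_pairs P S q0 h : seq (word * word) :=
  [seq (gen i, gen i) | i <- iota 0 (size P).+4.+1] ++ relators P S q0 h.

Lemma erase_relators P S q0 h u v : (u, v) \in relators P S q0 h ->
  erase (size P).+4.+1 u = u /\ erase (size P).+4.+1 v = v.
Proof.
set L := (size P).+4.+1.
have pow_erase i n : i < L -> erase L (pow i n) = pow i n.
  by move=> iL; rewrite /erase filter_nseq /= iL mul1n.
have cat_erase w w' : erase L w = w -> erase L w' = w' -> erase L (w ++ w') = w ++ w'.
  by rewrite /erase filter_cat => -> ->.
have conj_erase w w' : erase L w = w -> erase L w' = w' -> erase L (conjw w w') = conjw w w'.
  by move=> Hw Hw'; rewrite /conjw !erase_cat erase_winv Hw Hw'.
have lamp_erase n : erase L (lamp n) = lamp n by apply: conj_erase => //; apply: pow_erase.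
have start_erase : erase L (start_lamp S q0) = start_lamp S q0.
  by apply: conj_erase => //; apply: cat_erase; apply: pow_erase.
rewrite mem_cat 2!in_cons in_nil orbF -orbA => /or3P[/eqP E|/eqP E|].
- rewrite (congr1 fst E : u = kappa ++ lamp h) (congr1 snd E : v = lamp h ++ kappa).
  by split; apply: cat_erase.
- rewrite (congr1 fst E : u = zeta ++ start_lamp S q0 ++ kappa).
  rewrite (congr1 snd E : v = kappa ++ start_lamp S q0).
  by split; apply/cat_erase => //; apply/cat_erase.
move=> /flattenP[_ /mapP[i Hi ->]].
have iL : i.+4.+1 < L by move: Hi; rewrite mem_iota.
have stable_erase : erase L (stable i) = stable i by rewrite /erase /= iL.
rewrite /stable_relators 2!in_cons mem_seq1 => /or3P[] /eqP E;
  rewrite (congr1 fst E : u = _) (congr1 snd E : v = _) /fst /snd;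
  by split; apply/cat_erase => //; apply: pow_erase.
Qed.

Lemma has_corner_zero_input m P S q0 h K :
  {in P, forall I, I.1.2 < I.1.1 /\ I.2.2 < I.2.1} ->
  let X := pair_mx m (pow 1 K, gen 4) :: [seq pair_mx m p | p <- mihailova_pairs P S q0 h] in
  ((forall C, affine_invariant P C -> C h -> C (S * K + q0)) -> has_corner_zero X) /\
  ((exists C, [/\ affine_invariant P C, C h & ~ C (S * K + q0)]) -> ~ has_corner_zero X).
Proof.
move=> HP; rewrite -map_cons; set R := _ :: _ => X; rewrite {}/X.
(* The letter zeta has matrix with rows (1, 1) and (0, 1), so appending it moves this sum to the
   upper right entry, where ping-pong applies. *)
have wz (w : word) : (wmx w 0 0 + wmx w 0 1 = wmx (w ++ zeta) 0 1)%R.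
  by rewrite wmx_cat mulmx2E /= mulmx1 !mxE /= mulr1 mulr0 addr0 mulr1.
have o0 : 0 < 3 + (3 + m) by [].
split=> [H|[C [HC Ch nC]] [A [/in_gen_group_words[u [v [-> _ Huv]]] [i [j [i0 [j0 E]]]]]]].
- have HL : {in iota 0 (size P).+4.+1, forall i, (gen i, gen i) \in R}.
    by move=> i Hi; rewrite inE mem_cat (map_f (fun i => (gen i, gen i)) Hi) orbT.
  have Hc := in_gen_group_congruence m HL.
  have Hz : in_gen_group [seq pair_mx m p | p <- R] (pair_mx m (zeta, [::])).
    apply: (relators_derive Hc) H => u v; rewrite inE => /orP[/eqP E|uvR].
      rewrite (congr1 fst E : u = pow 1 K) (congr1 snd E : v = gen 4) /erase filter_nseq.
      by apply: in_gen_group_gen; rewrite mul1n inE eqxx.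
    have [-> ->] := erase_relators uvR.
    by apply: in_gen_group_gen; rewrite inE mem_cat uvR !orbT.
  exists (pair_mx m ([::], winv zeta)); split; last first.
    exists (Ordinal o0), (Ordinal o0); do 2 split=> //; rewrite /pair_mx Phi_corner // wz.
    by rewrite wmx_cat wmx_invl !mxE expr0n addr0.
  (* The witness arises as (zeta, zeta)^-1 (zeta, 1) = (1, zeta^-1). *)
  have Hg : in_gen_group [seq pair_mx m p | p <- R] (pair_mx m (zeta, zeta)).
    by apply/in_gen_group_gen/HL; rewrite mem_iota.
  have := in_gen_group_mul (in_gen_group_inv Hg) Hz; rewrite -pair_mxM.
  by congr (in_gen_group _ _); rewrite /pair_mx cats0 wmx_cat wmx_invl.
have [T [f [fK fR [x fx]]]] := relators_model HP HC Ch nC.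
have Huvf : wact f u =1 wact f v.
  apply: Huv => // u' v'; rewrite inE mem_cat => /or3P[H|/mapP[l _ [-> ->]] //|H].
    by apply: fR; rewrite inE H.
  by apply: fR; rewrite inE H orbT.
move: E; rewrite /pair_mx Phi_corner // wz => /eqP.
rewrite paddr_eq0 ?sqr_ge0 // !sqrf_eq0 => /andP[/eqP /wmx01_eq0 Hu /eqP /wmx01_eq0 Hv].
(* In the model [u] and [v ++ zeta] act trivially while [u] and [v] act equally, so zeta would act
   trivially. *)
apply: fx; rewrite -[RHS](Hv _ f) // wact_cat -Huvf Hu //.
Qed.

(** * Diagonalization *)

Lemma computable_input m : computable1 (fun k => pickle (pair_mx m (pow 1 (2 ^ k), gen 4))).
Proof.
apply: computable1_pickle_mx.
apply: (@eq_computableMx _ _ (fun k => Phi m (smx 1 (2 ^ k)%N%:R) (smx 4 1%N%:R))) => [k|].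
  by rewrite /pair_mx -!wmx_pow.
apply: computableMx_Phi; apply: computableMx_smx; first exact: computable1_pow2.
exact: computable1_const.
Qed.

Lemma pickle_cons (T : countType) (x : T) s :
  pickle (x :: s) = code_cons (pickle x) (pickle s).
Proof. by []. Qed.

Theorem theorem1 (n : nat) (hn : 6 <= n) :
  ~ exists c : rcode, decides_corner_problem n c.
Proof.
have [m ->] : exists m, n = 3 + (3 + m) by exists (n - 6); lia.
move=> [c Hc].
(* The argument [k] itself serves as the code of the tail of the list, so nothing has to be
   decoded. *)
have [input Hinput] : computable1 (fun k =>
    code_cons (pickle (pair_mx m (pow 1 (2 ^ k), gen 4))) k).
  exact: computable1_code_cons (computable_input m) computable1_id.
have [test Htest] : computable1 (fun y => y == 1 : nat).
  apply: (@eq_computable1 (fun y => if y <= 1 then if 1 <= y then 1 else 0 else 0)).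
    by case=> [|[|y]].
  by do !apply: computable1_if; try exact: computable1_const; exact: computable1_id.
have [P [S [q0 [h [HP HS]]]]] := rcode_affine (RComp test [:: RComp c [:: input]]).
(* The maps are compiled before [k] is chosen, so [k] may code the generators built from them; [X]
   is then the very list on which the program queries [c]. *)
pose X0 := [seq pair_mx m p | p <- mihailova_pairs P S q0 h]; pose k := pickle X0.
pose X := pair_mx m (pow 1 (2 ^ k), gen 4) :: X0.
have [|y [Hy Hy1]] := Hc X.
  apply/allP => A; rewrite /X -(map_cons (pair_mx m)) => /mapP[[u v] _ ->].
  exact: pair_mx_unit.
have [] := HS k (y == 1 : nat).
  apply: ev_comp1 (Htest y); apply: ev_comp1 Hy.
  by have := Hinput k; rewrite -pickle_cons.
have [yes no] := has_corner_zero_input m S q0 h (2 ^ k) HP.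
(* If [c] accepts, the nonzero output separates the start from [h], and no corner vanishes;
   otherwise they are connected, and some corner does. *)
case: eqP => [/Hy1 HX _ nH|y1 H _]; first exact: no (nH _) HX.
by case: y1; apply/Hy1/yes; exact: H.
Qed.
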